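(* Let $G$ be a tree on $n$ vertices. A balanced EPT of $G$ (as defined in the context) can be computed in time $O(n\log n)$.
   Context: An edge partition tree (EPT) of a tree $G$ is a rooted full binary tree defined inductively: if $G$ has a single vertex, its EPT is a single node (a leaf identified with that vertex); otherwise the root corresponds to an edge $e\in E(G)$ and its two children are roots of EPTs of the two components of $G\setminus e$. Thus leaves of the EPT are identified with the vertices of $G$ and internal nodes with the edges of $G$. For an internal node $x$ of an EPT $T$, let $G[x]$ denote the subtree of $G$ induced by the leaves of the subtree of $T$ rooted at $x$. An edge $e$ of a tree $H$ is balanced if it minimizes, over all edges of $H$, the number of vertices of the largest component of $H\setminus e$. A balanced EPT of $G$ is one produced by the balanced cut algorithm: the root is a balanced edge $e$ of $G$, and the children are roots of balanced EPTs of the components of $G\setminus e$, built recursively; equivalently, every internal node $x$ corresponds to a balanced edge of $G[x]$. *)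

(* Defs.v *)
From mathcomp Require Import all_boot.

Set Implicit Arguments.
Unset Strict Implicit.
Unset Printing Implicit Defensive.

(** * Trees *)

Record graph (T : finType) : Type := Graph {
  verts : {set T};
  edges : {set {set T}}
}.

Definition simple_graph (T : finType) (G : graph T) : Prop :=
  forall e, e \in edges G -> e \subset verts G /\ #|e| = 2.

Definition adj (T : finType) (G : graph T) : rel T :=
  [rel x y | [set x; y] \in edges G].

(* In a simple graph a [ucycle] of size at most 2 is empty or a single edge
   walked back and forth; those of size at least 3 are the actual cycles. *)
Definition is_tree (T : finType) (G : graph T) : Prop :=
  [/\ simple_graph G,
      verts G != set0,
      {in verts G &, forall x y, connect (adj G) x y} &
      forall c : seq T, ucycle (adj G) c -> size c <= 2].

Definition delete_edge (T : finType) (G : graph T) (e : {set T}) : graph T :=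
  Graph (verts G) (edges G :\ e).

(* Meant for [C \subset verts G]. *)
Definition induced (T : finType) (G : graph T) (C : {set T}) : graph T :=
  Graph C (edges G ::&: C).

Definition components (T : finType) (G : graph T) : {set {set T}} :=
  equivalence_partition (connect (adj G)) (verts G).

(** * Edge partition trees *)

Definition largest_component (T : finType) (H : graph T) (e : {set T}) : nat :=
  \max_(C in components (delete_edge H e)) #|C|.

Definition balanced (T : finType) (H : graph T) (e : {set T}) : Prop :=
  e \in edges H /\
  forall f, f \in edges H -> largest_component H e <= largest_component H f.

Inductive ept (T : finType) : Type :=
  | Leaf of T
  | Node of {set T} & ept T & ept T.

(* [ept_by cut G t]: [t] is an edge partition tree of [G] each of whose
   internal nodes is an edge [e] with [cut H e], [H] being the subtree of [G]
   spanned by the leaves below that node. *)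
Inductive ept_by (T : finType) (cut : graph T -> {set T} -> Prop) :
    graph T -> ept T -> Prop :=
  | ept_leaf H v : verts H = [set v] -> ept_by cut H (Leaf v)
  | ept_node H e C1 C2 t1 t2 :
      cut H e -> C1 != C2 -> components (delete_edge H e) = [set C1; C2] ->
      ept_by cut (induced (delete_edge H e) C1) t1 ->
      ept_by cut (induced (delete_edge H e) C2) t2 ->
      ept_by cut H (Node e t1 t2).

Definition is_ept (T : finType) : graph T -> ept T -> Prop :=
  ept_by (fun H e => e \in edges H).

Definition balanced_ept (T : finType) : graph T -> ept T -> Prop :=
  ept_by (@balanced T).

Lemma balanced_ept_is_ept (T : finType) (G : graph T) (t : ept T) :
  balanced_ept G t -> is_ept G t.
Proof.
elim=> [H v eqH|H e C1 C2 t1 t2 [He _] neqC compsH _ IH1 _ IH2].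
  exact: ept_leaf.
exact: ept_node neqC compsH IH1 IH2.
Qed.

(** * Word RAM

   Unit-cost random access machine, presented as a structured language over
   registers and zero-initialised arrays. A program mentions finitely many
   registers and arrays by name, so interleaving them in a single memory costs
   only a constant factor. *)

Inductive binop : Type := Add | Sub | Less | Equal.

Inductive expr : Type :=
  | Lit of nat
  | Reg of nat
  | Get of nat & expr                (* [Get a i] reads cell [i] of array [a] *)
  | Bin of binop & expr & expr.

Inductive prog : Type :=
  | Skip
  | SetReg of nat & expr
  | Put of nat & expr & expr         (* [Put a i e] sets cell [i] of array [a] *)
  | Seq of prog & prog
  | If of expr & prog & prog
  | While of expr & prog.

Record state : Type := State {
  reg : nat -> nat;
  arr : nat -> nat -> nat
}.

Definition set_reg (s : state) (x v : nat) : state :=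
  State [fun y => reg s y with x |-> v] (arr s).

Definition set_arr (s : state) (a i v : nat) : state :=
  State (reg s) (fun b j => if (b == a) && (j == i) then v else arr s b j).

Definition binop_val (o : binop) (m n : nat) : nat :=
  match o with
  | Add => m + n
  | Sub => m - n
  | Less => m < n
  | Equal => m == n
  end.

Fixpoint value (s : state) (e : expr) : nat :=
  match e with
  | Lit k => k
  | Reg x => reg s x
  | Get a i => arr s a (value s i)
  | Bin o e1 e2 => binop_val o (value s e1) (value s e2)
  end.

(* No intermediate value, and hence no address, overflows a word of [w] bits. *)
Fixpoint fits (w : nat) (s : state) (e : expr) : bool :=
  (value s e < 2 ^ w) &&
  match e with
  | Lit _ | Reg _ => true
  | Get _ i => fits w s i
  | Bin _ e1 e2 => fits w s e1 && fits w s e2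
  end.

Fixpoint cost (e : expr) : nat :=
  match e with
  | Lit _ | Reg _ => 1
  | Get _ i => (cost i).+1
  | Bin _ e1 e2 => (cost e1 + cost e2).+1
  end.

(* [exec w p s t s']: with [w]-bit words, [p] started in [s] halts in [s']
   after [t] steps. Overflow is a fault: it admits no derivation. *)
Inductive exec (w : nat) : prog -> state -> nat -> state -> Prop :=
  | exec_skip s : exec w Skip s 1 s
  | exec_reg s x e :
      fits w s e ->
      exec w (SetReg x e) s (cost e).+1 (set_reg s x (value s e))
  | exec_put s a i e :
      fits w s i -> fits w s e ->
      exec w (Put a i e) s (cost i + cost e).+1
        (set_arr s a (value s i) (value s e))
  | exec_seq s t1 s1 t2 s2 p q :
      exec w p s t1 s1 -> exec w q s1 t2 s2 -> exec w (Seq p q) s (t1 + t2) s2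
  | exec_if s t s' e p q :
      fits w s e -> exec w (if value s e != 0 then p else q) s t s' ->
      exec w (If e p q) s (cost e + t).+1 s'
  | exec_while_stop s e p :
      fits w s e -> value s e = 0 -> exec w (While e p) s (cost e).+1 s
  | exec_while_step s t1 s1 t2 s2 e p :
      fits w s e -> value s e != 0 ->
      exec w p s t1 s1 -> exec w (While e p) s1 t2 s2 ->
      exec w (While e p) s (cost e + t1 + t2).+1 s2.

(** * Input and output *)

Definition edge_of (n : nat) (p : 'I_n * 'I_n) : {set 'I_n} := [set p.1; p.2].

(* [es] lists every edge of [G] once, in any order and orientation. *)
Definition edge_list (n : nat) (G : graph 'I_n) (es : seq ('I_n * 'I_n)) :
    Prop :=
  perm_eq [seq edge_of p | p <- es] (enum (edges G)).

(* Register 0 holds [n]; cell [i] of arrays 0 and 1 holds the two ends of the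
   [i]-th edge; everything else is 0. *)
Definition input (n : nat) (es : seq ('I_n * 'I_n)) : state :=
  State (fun x => if x == 0 then n else 0)
        (fun a i => match a with
                    | 0 => nth 0 [seq val p.1 | p <- es] i
                    | 1 => nth 0 [seq val p.2 | p <- es] i
                    | _ => 0
                    end).

(* [outputs es s k t]: node number [k] in the memory [s] is the root of [t].
   Number [v < n] is the leaf [v] and number [n + i] is the internal node of
   the [i]-th edge, whose children are in cell [i] of arrays 2 and 3. *)
Fixpoint outputs (n : nat) (es : seq ('I_n * 'I_n)) (s : state) (k : nat)
    (t : ept 'I_n) : Prop :=
  match t with
  | Leaf v => k = v
  | Node e t1 t2 =>
      exists i : nat,
        [/\ k = n + i, onth [seq edge_of p | p <- es] i = Some e,
            outputs es s (arr s 2 i) t1 & outputs es s (arr s 3 i) t2]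
  end.

Definition bigO (f g : nat -> nat) : Prop :=
  exists c N : nat, forall n, N <= n -> f n <= c * g n.

(* Main.v *)
(* Let [c] be a centroid of a piece with [m] vertices. Of the edges at [c], the
   one that separates the largest part from [c] is balanced. After this part is
   cut off, the next largest part separated by an edge at [c] yields a balanced
   edge of what remains, as long as it contains at most half of what remains.
   Stopping at the first edge for which this fails leaves parts of at most
   [2 m / 3] vertices, so all pieces are single vertices after [O(log n)] such
   rounds. A round takes time [O(n)]: the tree is rooted once and for all by
   stripping leaves, with the vertices numbered in the order of removal, so that
   the sizes of subtrees, the roots and the centroids of the pieces are found by
   plain loops, and the edges at the centroids are sorted with buckets. *)
Require Import Defs.
From mathcomp Require Import all_boot zify.

Set Implicit Arguments.
Unset Strict Implicit.
Unset Printing Implicit Defensive.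

(** * Costs and weakest preconditions *)

(** The overview leaves open how balance can be known without recomputing sizes after each cut.
    Every edge gets a [key], the size of its smaller side in its piece as it was at the start of the
    round. For an edge at the centroid this is the side away from the centroid, and cuts at the
    other edges of the centroid never touch that side; so the key stays exact, and each cut shrinks
    the central part by exactly the key. An edge elsewhere in the central part lies behind an uncut
    edge at the centroid, whose key is at least as large. Hence the uncut edge with the largest key
    is balanced, provided that this key is at most half of the current part, and sorting by key once
    per round suffices. The tree is emitted from its root downwards: each piece carries the address
    of the output cell that waits for its subtree, and a cut fills one such cell and opens two.
    Words must hold a multiple of [n ^ 2], because stripping stores for each vertex the sum of the
    indices of its edges. *)

Fixpoint magnitude (e : expr) : nat :=
  match e with
  | Lit k => k.+1
  | Reg _ => 1
  | Get _ i => (magnitude i).+1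
  | Bin _ e1 e2 => (magnitude e1 + magnitude e2).+1
  end.

Fixpoint prog_magnitude (p : prog) : nat :=
  match p with
  | Skip => 1
  | SetReg _ e => magnitude e
  | Put _ i e => maxn (magnitude i) (magnitude e)
  | Seq p q => maxn (prog_magnitude p) (prog_magnitude q)
  | If e p q => maxn (magnitude e) (maxn (prog_magnitude p) (prog_magnitude q))
  | While e p => maxn (magnitude e) (prog_magnitude p)
  end.

(** The [0] for loops is a dummy: actual times are reached only through [runs_wp], whose hypothesis
    [wp] is [False] on a loop. *)
Fixpoint duration (p : prog) : nat :=
  match p with
  | Skip => 1
  | SetReg _ e => (cost e).+1
  | Put _ i e => (cost i + cost e).+1
  | Seq p q => duration p + duration q
  | If e p q => (cost e + maxn (duration p) (duration q)).+1
  | While e p => 0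
  end.

Fixpoint written_regs (p : prog) : seq nat :=
  match p with
  | Skip | Put _ _ _ => [::]
  | SetReg x _ => [:: x]
  | Seq p q | If _ p q => written_regs p ++ written_regs q
  | While _ p => written_regs p
  end.

Fixpoint written_arrs (p : prog) : seq nat :=
  match p with
  | Skip | SetReg _ _ => [::]
  | Put a _ _ => [:: a]
  | Seq p q | If _ p q => written_arrs p ++ written_arrs q
  | While _ p => written_arrs p
  end.

Definition same_off (p : prog) (s s' : state) : Prop :=
  (forall x, x \notin written_regs p -> reg s' x = reg s x) /\
  (forall a i, a \notin written_arrs p -> arr s' a i = arr s a i).

(** A syntactic frame rule: facts about registers and arrays that a loop does not write pass through
    it without entering its invariant. *)
Lemma exec_same_off w p s t s' : exec w p s t s' -> same_off p s s'.
Proof.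
elim=> {p s t s'}.
- by [].
- by move=> s x e _; split=> //= y; rewrite inE => /negbTE ->.
- by move=> s a i e _ _; split=> //= b j; rewrite inE => /negbTE ->.
- move=> s t1 s1 t2 s2 p q _ [r1 a1] _ [r2 a2]; split=> [x|a i];
    by rewrite mem_cat negb_or => /andP[h1 h2]; rewrite ?r2 ?r1 ?a2 ?a1.
- move=> s t s' e p q _ _ [r a]; split=> [x|b i];
    rewrite mem_cat negb_or => /andP[h1 h2]; rewrite ?r ?a //; by case: ifP.
- by [].
- move=> s t1 s1 t2 s2 e p _ _ _ [r1 a1] _ [r2 a2]; split=> [x|a i] h;
    by rewrite ?r2 ?r1 ?a2 ?a1.
Qed.

Definition bounded (X : nat) (s : state) : Prop :=
  (forall x, reg s x <= X) /\ (forall a i, arr s a i <= X).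

(* Expressions whose value in a memory bounded by [X] is at most [X]. *)
Fixpoint tame (e : expr) : bool :=
  match e with
  | Lit k => k <= 1
  | Reg _ | Get _ _ => true
  | Bin Add _ _ => false
  | Bin Defs.Sub e1 _ => tame e1
  | Bin _ _ _ => true
  end.

(** Tame right-hand sides are bounded for free, so in practice only sums leave a proof
    obligation. *)
Definition small (X : nat) (s : state) (e : expr) (Q : Prop) : Prop :=
  if tame e then Q else value s e <= X /\ Q.
Arguments small X s !e Q /.

(* Weakest precondition of a loop-free program, with the side condition that
   every stored value be at most [X]. *)
Fixpoint wp (X : nat) (p : prog) (Q : state -> Prop) (s : state) : Prop :=
  match p with
  | Skip => Q s
  | SetReg x e =>
      small X s e (forall v, v = value s e -> Q (set_reg s x v))
  | Put a i e =>
      small X s e (Q (set_arr s a (value s i) (value s e)))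
  | Seq p q => wp X p (wp X q Q) s
  | If e p q => if value s e != 0 then wp X p Q s else wp X q Q s
  | While _ _ => False
  end.

Lemma reg_set_eq s x v : reg (set_reg s x v) x = v.
Proof. by rewrite /set_reg /= eqxx. Qed.

Lemma reg_set_neq s x y v : y != x -> reg (set_reg s x v) y = reg s y.
Proof. by rewrite /set_reg /= => /negbTE ->. Qed.

(** * Running programs in a bounded memory without overflow *)

Section Machine.

Variables w X : nat.
Hypothesis X_gt0 : 0 < X.

Lemma value_le s e : bounded X s -> value s e <= magnitude e * X.
Proof.
move=> [br ba]; elim: e => [k|x|a i IH|o e1 IH1 e2 IH2] /=.
- by rewrite mulSn; have := leq_pmulr k X_gt0; lia.
- by rewrite mul1n.
- by apply: leq_trans (ba _ _) _; rewrite mulSn leq_addr.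
- rewrite mulSn mulnDl; by case: o => /=; lia.
Qed.

(** Subexpressions have smaller magnitude, so one inequality for the whole expression covers all
    intermediate values and addresses. *)
Lemma fits_bounded s e : bounded X s -> magnitude e * X < 2 ^ w -> fits w s e.
Proof.
move=> bs; elim: e => [k|x|a i IH|o e1 IH1 e2 IH2] h /=;
  rewrite (leq_ltn_trans (value_le _ bs) h) //=.
- by apply: IH; apply: leq_ltn_trans h; rewrite /= leq_mul2r leqnSn orbT.
- by rewrite IH1 ?IH2 //; apply: leq_ltn_trans h; rewrite /= leq_mul2r; lia.
Qed.

Lemma tame_le s e : bounded X s -> tame e -> value s e <= X.
Proof.
move=> [br ba]; elim: e => [k|x|a i IH|o e1 IH1 e2 IH2] //=.
- by move=> h; apply: leq_trans h X_gt0.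
- case: o => //=.
  + by move=> /IH1; lia.
  + by move=> _; case: (_ < _).
  + by move=> _; case: (_ == _).
Qed.

Lemma smallP s e (Q : Prop) : bounded X s -> small X s e Q -> value s e <= X /\ Q.
Proof. by rewrite /small => bs; case: ifP => // te q; split=> //; apply: tame_le. Qed.

Lemma bounded_set_reg s x v : bounded X s -> v <= X -> bounded X (set_reg s x v).
Proof. by move=> [br ba] hv; split=> //= y; case: ifP. Qed.

Lemma bounded_set_arr s a i v : bounded X s -> v <= X -> bounded X (set_arr s a i v).
Proof. by move=> [br ba] hv; split=> //= b j; case: ifP. Qed.

(** Total correctness within [T] steps. Boundedness belongs to the outcome so that the next command
    can again be shown free of overflow. *)
Definition runs (p : prog) (s : state) (T : nat) (Q : state -> Prop) : Prop :=
  exists t s', [/\ exec w p s t s', t <= T, bounded X s' & Q s'].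

Lemma runs_weaken p s T T' (Q Q' : state -> Prop) :
  runs p s T Q -> T <= T' ->
  (forall s', bounded X s' -> Q s' -> Q' s') -> runs p s T' Q'.
Proof.
move=> [t [s' [ex tT bs' qs]]] TT' QQ'; exists t, s'; split=> //.
  exact: leq_trans TT'.
exact: QQ'.
Qed.

Lemma runs_same_off p s T Q :
  runs p s T Q -> runs p s T (fun s' => Q s' /\ same_off p s s').
Proof.
move=> [t [s' [ex tT bs' qs]]]; exists t, s'; split=> //; split=> //.
exact: exec_same_off ex.
Qed.

Lemma runs_seq p q s T1 T2 Q R :
  runs p s T1 Q ->
  (forall s', bounded X s' -> Q s' -> runs q s' T2 R) ->
  runs (Seq p q) s (T1 + T2) R.
Proof.
move=> [t [s' [ex tT bs' qs]]] /(_ _ bs' qs) [t2 [s2 [ex2 tT2 bs2 rs]]].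
by exists (t + t2), s2; split=> //; [exact: exec_seq ex ex2 | exact: leq_add].
Qed.

Lemma runs_wp p s Q :
  prog_magnitude p * X < 2 ^ w -> bounded X s -> wp X p Q s ->
  runs p s (duration p) Q.
Proof.
elim: p s Q => [|x e|a i e|p IHp q IHq|e p IHp q IHq|e p IHp] s Q //= mp bs.
- by move=> qs; exists 1, s; split=> //; apply: exec_skip.
- move=> /(smallP bs) [ve qs].
  exists (cost e).+1, (set_reg s x (value s e)); split=> //; last exact: qs.
    exact/exec_reg/fits_bounded.
  exact: bounded_set_reg.
- move=> /(smallP bs) [ve qs].
  have [mi me] : magnitude i * X < 2 ^ w /\ magnitude e * X < 2 ^ w.
    by split; apply: leq_ltn_trans mp; rewrite leq_mul2r ?leq_maxl ?leq_maxr orbT.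
  exists (cost i + cost e).+1, (set_arr s a (value s i) (value s e)); split=> //.
    by apply: exec_put; apply: fits_bounded.
  exact: bounded_set_arr.
- have [m1 m2] : prog_magnitude p * X < 2 ^ w /\ prog_magnitude q * X < 2 ^ w.
    by split; apply: leq_ltn_trans mp; rewrite leq_mul2r ?leq_maxl ?leq_maxr orbT.
  move=> /(IHp _ _ m1 bs) run1; apply: runs_seq run1 _ => s' bs'.
  exact: IHq.
- have [me m1 m2] : [/\ magnitude e * X < 2 ^ w, prog_magnitude p * X < 2 ^ w
      & prog_magnitude q * X < 2 ^ w].
    by split; apply: leq_ltn_trans mp; rewrite leq_mul2r; apply/orP; right; lia.
  move=> hif.
  have [t [s' [ex tT bs' qs]]] :
      runs (if value s e != 0 then p else q) s (maxn (duration p) (duration q)) Q.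
    move: hif; case: ifP => _ hq.
      by apply: runs_weaken (IHp _ _ m1 bs hq) _ _; rewrite ?leq_maxl.
    by apply: runs_weaken (IHq _ _ m2 bs hq) _ _; rewrite ?leq_maxr.
  exists (cost e + t).+1, s'; split=> //.
    by apply: exec_if ex; apply: fits_bounded.
  by rewrite ltnS leq_add2l.
Qed.

(** The index of [I] is a variant and may drop by any positive amount, which leaves room for
    amortised bounds. *)
Lemma runs_while e p (I : nat -> state -> Prop) D k s :
  magnitude e * X < 2 ^ w ->
  (forall k s, bounded X s -> I k s -> value s e != 0 ->
     runs p s D (fun s' => exists2 k', k' < k & I k' s')) ->
  bounded X s -> I k s ->
  runs (While e p) s (k * (D + (cost e).+1) + (cost e).+1)
    (fun s' => value s' e = 0 /\ exists k', I k' s').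
Proof.
move=> me body; elim/ltn_ind: k s => k IH s bs Is.
case: (eqVneq (value s e) 0) => [v0|vn0].
  exists (cost e).+1, s; split=> //; last by split=> //; exists k.
    by apply: exec_while_stop => //; apply: fits_bounded.
  exact: leq_addl.
have [t1 [s1 [ex1 tT1 bs1 [k' kk' Is1]]]] := body _ _ bs Is vn0.
have [t2 [s2 [ex2 tT2 bs2 post]]] := IH _ kk' _ bs1 Is1.
exists (cost e + t1 + t2).+1, s2; split=> //.
  by apply: exec_while_step ex1 ex2 => //; apply: fits_bounded.
have : k'.+1 * (D + (cost e).+1) <= k * (D + (cost e).+1) by rewrite leq_mul2r kk' orbT.
by rewrite mulSn; lia.
Qed.

End Machine.

(** * Counting loops up to the content of register 0 *)

Definition For (i : nat) (body : prog) : prog :=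
  Seq (SetReg i (Lit 0))
      (While (Bin Less (Reg i) (Reg 0))
             (Seq body (SetReg i (Bin Add (Reg i) (Lit 1))))).

(** Test and increment cost 4 each per iteration; the 6 consists of 2 for the initialisation and 4
    for the last, failing test. *)
Definition for_time (n D : nat) : nat := n * (D + 8) + 6.

Lemma runs_for w X n i body D (I : nat -> state -> Prop) s :
  0 < X -> n < X -> 4 * X < 2 ^ w ->
  i != 0 -> i \notin written_regs body -> 0 \notin written_regs body ->
  (forall k s v, I k s -> I k (set_reg s i v)) ->
  (forall k s, k < n -> bounded X s -> reg s 0 = n -> reg s i = k -> I k s ->
     runs w X body s D (I k.+1)) ->
  bounded X s -> reg s 0 = n -> I 0 s ->
  runs w X (For i body) s (for_time n D) (I n).
Proof.
move=> X0 nX X4 i0 ib zb Iset step bs rn Is.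
pose J m s := [/\ reg s 0 = n, reg s i + m = n & I (reg s i) s].
have -> : for_time n D = 2 + (n * (D + 4 + 4) + 4) by rewrite /for_time; lia.
apply: (@runs_seq _ _ _ _ _ _ _ (J n)).
  apply: (@runs_weaken _ _ _ _ 2 2 (J n)) => //.
  apply: (@runs_wp _ _ X0 (SetReg i (Lit 0))) => //=; first by lia.
  move=> v ->; rewrite /J reg_set_eq reg_set_neq 1?eq_sym //; split=> //.
  exact: Iset.
move=> s1 bs1 J1.
apply: (@runs_weaken _ _ _ _ _ _ _ _ (@runs_while _ _ X0 _ _ J (D + 4) n s1 _ _ bs1 J1)) => //=.
  by lia.
  move=> m s2 bs2 [r0 ri Ii] /=; case: (ltnP (reg s2 i) (reg s2 0)) => // lti _.
  apply: (@runs_seq _ _ _ _ _ _ _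
    (fun s' => I (reg s2 i).+1 s' /\ same_off body s2 s')).
    by apply: runs_same_off; apply: step => //; rewrite -r0.
  move=> s3 bs3 [I3 [rs3 _]].
  apply: (@runs_wp _ _ X0 (SetReg i (Bin Add (Reg i) (Lit 1)))) => //=.
  rewrite /small /= rs3 //; split; first by lia.
  move=> v ->; exists m.-1; first by lia.
  rewrite /J reg_set_eq reg_set_neq 1?eq_sym // rs3 // addn1.
  by split=> //; [lia | apply: Iset].
move=> s2 bs2 [v0 [k [r0 ri Ii]]].
have -> : n = reg s2 i by move: v0; case: (ltnP (reg s2 i) (reg s2 0)) => //; lia.
by [].
Qed.

(** The 64 is a common cap on the magnitudes of all loop bodies, so that the side conditions on a
    concrete body are settled by computation. *)
Lemma runs_for_wp w X n i body D (I : nat -> state -> Prop) s :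
  64 * X < 2 ^ w -> n < X -> prog_magnitude body <= 64 -> duration body <= D ->
  [&& i != 0, i \notin written_regs body & 0 \notin written_regs body] ->
  (forall k s v, I k s -> I k (set_reg s i v)) ->
  (forall k s, k < n -> bounded X s -> reg s 0 = n -> reg s i = k -> I k s ->
     wp X body (I k.+1) s) ->
  bounded X s -> reg s 0 = n -> I 0 s ->
  runs w X (For i body) s (for_time n D)
    (fun s' => I n s' /\ same_off (For i body) s s').
Proof.
move=> wX nX mag dur /and3P[i0 ib zb] Iset step bs rn I0.
have X0 : 0 < X by lia.
apply: runs_same_off; apply: runs_for => //; first by lia.
move=> k s' kn bs' r0 ri Ik.
apply: (runs_weaken (runs_wp X0 _ bs' (step _ _ kn bs' r0 ri Ik))) => //.
by apply: leq_ltn_trans wX; rewrite leq_mul2r mag orbT.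
Qed.

Lemma wp_mono X p (Q Q' : state -> Prop) s :
  (forall s', Q s' -> Q' s') -> wp X p Q s -> wp X p Q' s.
Proof.
elim: p s Q Q' => [|x e|a i e|p IHp q IHq|e p IHp q IHq|e p IHp] s Q Q' QQ' //=.
- exact: QQ'.
- by rewrite /small; case: ifP => _ => [h v|[? h]]; [| split=> // v] => /h /QQ'.
- by rewrite /small; case: ifP => _ => [/QQ'|[? /QQ']].
- by apply: IHp => s'; apply: IHq.
- by case: ifP => _; [apply: IHp | apply: IHq].
Qed.

(** * Rooted trees with deleted edges *)

Section Forest.

Variables (N : nat) (p : 'I_N.+1 -> 'I_N.+1).
Local Notation T := 'I_N.+1.
Hypothesis p_gt : forall j : T, j != ord_max -> j < p j.

Implicit Types (K : {set T}) (x y i j c r f b : T).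

(* A tree on the positions [0 .. N], rooted at [ord_max]. The edge from a position
   to its parent is named after the position, and [K] consists of the positions
   whose edge is deleted together with the root. So [K] is the set of the roots of
   the pieces, and [below K r] is the piece with root [r]. *)
Definition ascend K x := if x \in K then x else p x.
Definition top K x := iter N.+1 (ascend K) x.
Definition below K i : {set T} := [set x | fconnect (ascend K) x i].

Lemma below_refl K i : i \in below K i.
Proof. by rewrite inE connect0. Qed.

Lemma below_trans K i j x : x \in below K i -> i \in below K j -> x \in below K j.
Proof. rewrite !inE; exact: connect_trans. Qed.

Lemma below_stop K i x : x \in K -> (x \in below K i) = (x == i).
Proof.
move=> xK; rewrite inE fconnect_eqVf /ascend xK.
apply/idP/idP => [/orP[|]//|->//].
case/connectP=> s; elim: s => [_ ->//|y s IH] /= /andP[/eqP <-].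
by rewrite /= /ascend xK; apply: IH.
Qed.

Lemma below_step K i x :
  x \notin K -> (x \in below K i) = (x == i) || (p x \in below K i).
Proof.
move=> xK; have e : ascend K x = p x by rewrite /ascend (negbTE xK).
by rewrite !inE fconnect_eqVf e.
Qed.

Lemma notin_neq_max K x : ord_max \in K -> x \notin K -> x != ord_max.
Proof. by move=> mK; apply: contraNneq => ->. Qed.

Lemma lt_p K x : ord_max \in K -> x \notin K -> x < p x.
Proof. by move=> mK xK; apply/p_gt/(notin_neq_max mK xK). Qed.

(** Parents have larger numbers, so [N - x] decreases along the ascent; this is an induction that
    starts at the roots of the pieces. *)
Lemma ascend_ind K (P : T -> Prop) : ord_max \in K ->
  (forall x, x \in K -> P x) ->
  (forall x, x \notin K -> P (p x) -> P x) -> forall x, P x.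
Proof.
move=> mK PK PS x; have [m] := ubnP (N - x); elim: m x => // m IH x hm.
case: (boolP (x \in K)) => xK; first exact: PK.
apply: PS => //; apply: IH; have := lt_p mK xK; have := ltn_ord (p x); lia.
Qed.

(** * Subtrees and roots for a fixed set of cuts *)

Section OneCutSet.
Variable K : {set T}.
Hypothesis maxK : ord_max \in K.

Lemma below_le i x : x \in below K i -> x <= i.
Proof.
move: x; apply: (ascend_ind maxK) => [x xK|x xK IH]; first by rewrite below_stop // => /eqP ->.
rewrite below_step // => /orP[/eqP -> //|/IH]; have := lt_p maxK xK; lia.
Qed.

Lemma below_anti i j : i \in below K j -> j \in below K i -> i = j.
Proof. by move=> /below_le h1 /below_le h2; apply/val_inj; apply/anti_leq/andP. Qed.

(** The ascent from [x] is a single path, and both positions lie on it. *)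
Lemma below_total i j x :
  x \in below K i -> x \in below K j -> i \in below K j \/ j \in below K i.
Proof.
move: x; apply: (ascend_ind maxK) => [x xK|x xK IH].
  by rewrite !(below_stop _ xK) => /eqP -> /eqP ->; left; apply: below_refl.
case: (eqVneq x i) => [->|ni]; first by left.
case: (eqVneq x j) => [->|nj]; first by right.
by rewrite !(below_step _ xK) (negbTE ni) (negbTE nj); apply: IH.
Qed.

Lemma top_fix x : x \in K -> top K x = x.
Proof.
by move=> xK; apply: iter_fix; rewrite /ascend xK.
Qed.

Lemma top_in x : top K x \in K.
Proof.
(* Within [m] steps a position is absorbed by [K] or rises by at least [m], and no position exceeds
   [N], which is in [K]. *)
suff h m : N <= m + x -> iter m (ascend K) x \in K by apply: h; lia.
elim: m x => [|m IH] x hm /=.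
  by rewrite (_ : x = ord_max) //; apply/val_inj => /=; have := ltn_ord x; lia.
rewrite -iterS iterSr; case: (boolP (x \in K)) => xK.
  have ax : ascend K x = x by rewrite /ascend xK.
  by rewrite ax iter_fix.
by apply: IH; rewrite /ascend (negbTE xK); have := lt_p maxK xK; lia.
Qed.

Lemma top_p x : x \notin K -> top K (p x) = top K x.
Proof.
move=> xK; have px : p x = ascend K x by rewrite /ascend (negbTE xK).
rewrite px /top -iterSr iterS -/(top K x) /ascend top_in //.
Qed.

Lemma below_top x : x \in below K (top K x).
Proof. by rewrite inE; apply: fconnect_iter. Qed.

Lemma top_below x i : x \in below K i -> top K x = top K i.
Proof.
move: x; apply: (ascend_ind maxK) => [x xK|x xK IH]; first by rewrite below_stop // => /eqP ->.
by rewrite below_step // => /orP[/eqP -> //|/IH]; rewrite top_p.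
Qed.

Lemma below_root x r : r \in K -> (x \in below K r) = (top K x == r).
Proof.
move=> rK; apply/idP/eqP => [/top_below|<-]; last exact: below_top.
by rewrite (top_fix rK).
Qed.

Lemma below_child c x : x \in below K c -> x != c ->
  exists b, [/\ b \notin K, p b = c & x \in below K b].
Proof.
move: x; apply: (ascend_ind maxK) => [x xK|x xK IH].
  by rewrite below_stop // => ->.
rewrite below_step // => /orP[-> //|px] xc.
case: (eqVneq (p x) c) => [pc|pc]; first by exists x; rewrite below_refl.
have [b [bK pb xb]] := IH px pc; exists b; split=> //.
by rewrite below_step // xb orbT.
Qed.

Lemma below_sub_root i : below K i \subset below K (top K i).
Proof. by apply/subsetP => x xi; apply: below_trans xi (below_top i). Qed.

End OneCutSet.

Lemma below_mono K K' i : ord_max \in K -> K \subset K' -> below K' i \subset below K i.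
Proof.
move=> mK sK; apply/subsetP => x; move: x; apply: (ascend_ind mK) => [x xK|x xK IH].
  by rewrite !below_stop // (subsetP sK).
case: (boolP (x \in K')) => xK'.
  by rewrite below_stop // => /eqP ->; apply: below_refl.
by rewrite (below_step _ xK) (below_step _ xK') => /orP[-> //|/IH ->]; rewrite orbT.
Qed.

(** The two cut sets may be incomparable: ascending from [x] one meets [b] or a root of [K'], and up
    to that moment both ascents agree. *)
Lemma below_walk K K' b x : ord_max \in K -> ord_max \in K' ->
  x \in below K b -> x \in below K' b \/ top K' x \in below K b.
Proof.
move=> mK mK'; move: x; apply: (ascend_ind mK) => [x xK|x xK IH].
  by rewrite below_stop // => /eqP ->; left; apply: below_refl.
case: (eqVneq x b) => [->|xb]; first by left; apply: below_refl.
case: (boolP (x \in K')) => xK' xinb; first by right; rewrite top_fix.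
move: xinb; rewrite (below_step _ xK) (below_step _ xK') (negbTE xb) /=.
by move=> /IH[->|]; [left | rewrite top_p //; right].
Qed.

Lemma top_mono K K' x : ord_max \in K -> K \subset K' -> top K (top K' x) = top K x.
Proof.
move=> mK sK; have mK' := subsetP sK _ mK.
by apply/esym/top_below => //; apply: (subsetP (below_mono _ mK sK)); apply: below_top.
Qed.

(** * The effect of one more cut *)

Section Cut.
Variables (K : {set T}) (j : T).
Hypotheses (maxK : ord_max \in K) (jK : j \notin K).
Let K' := j |: K.

Let maxK' : ord_max \in K'. Proof. by rewrite inE maxK orbT. Qed.

Lemma below_cut i :
  below K' i = if (j \in below K i) && (i != j) then below K i :\: below K j
               else below K i.
Proof.
apply/setP=> x; move: x; apply: (ascend_ind maxK') => [x xK'|x xK' IH].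
  rewrite (below_stop _ xK'); move: xK'; rewrite in_setU1 => /orP[/eqP ->{x}|xK].
    rewrite eq_sym; case: eqVneq => [->|ij]; first by rewrite andbF below_refl.
    by rewrite andbT; case: ifP => [|->] //; rewrite in_setD below_refl.
  have xj : x != j by apply: contraNneq jK => <-.
  by case: ifP => _; rewrite ?in_setD !(below_stop _ xK) ?(negbTE xj).
rewrite (below_step _ xK') IH; move: xK'.
rewrite in_setU1 negb_or => /andP[xj xK].
case: ifP => h; rewrite ?in_setD !(below_step _ xK) ?(negbTE xj) //=.
case: (eqVneq x i) => [xi|] //=; rewrite andbT; move: h => /andP[ji ij].
apply/esym/negP => pxj; move/eqP: ij; apply.
by apply: (below_anti maxK) => //; rewrite -xi below_step // pxj orbT.
Qed.

Lemma top_cut x : top K' x = if x \in below K j then j else top K x.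
Proof.
have jK' : j \in K' by rewrite !inE eqxx.
move: x; apply: (ascend_ind maxK') => [x xK'|x xK' IH].
  rewrite (top_fix xK'); move: xK'; rewrite in_setU1 => /orP[/eqP ->|xK].
    by rewrite below_refl.
  have xj : x != j by apply: contraNneq jK => <-.
  by rewrite below_stop // (negbTE xj) top_fix.
rewrite -(top_p maxK' xK'); move: xK'; rewrite in_setU1 negb_or => /andP[xj xK].
by rewrite IH (below_step _ xK) (negbTE xj) /= top_p.
Qed.

Lemma below_cut_self : below K' j = below K j.
Proof. by rewrite below_cut eqxx andbF. Qed.

Lemma below_cut_top : below K' (top K j) = below K (top K j) :\: below K j.
Proof.
rewrite below_cut below_top // (_ : top K j != j) //.
by apply: contraNneq jK => <-; apply: top_in.
Qed.

Lemma below_cut_other r : r \in K -> r != top K j -> below K' r = below K r.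
Proof. by move=> rK rj; rewrite below_cut below_root // eq_sym (negbTE rj). Qed.

End Cut.

(** * Cuts at the centroid of one piece *)

Section Centroid.

Variable K0 : {set T}.
Hypothesis max0 : ord_max \in K0.

Definition size0 x := #|below K0 x|.
(** The smaller side of the edge above [j], always measured in the pieces of [K0], the cut set at
    the start of the round. *)
Definition key j := minn (size0 j) (size0 (top K0 j) - size0 j).

Variables r c : T.
Hypotheses (rK0 : r \in K0) (top_c : top K0 c = r)
  (c_heavy : size0 r < (size0 c).*2)
  (c_light : forall b, b \notin K0 -> p b = c -> (size0 b).*2 <= size0 r).

(** Edges are named by their lower ends, so the edges at [c] are its own one and those of its
    children. *)
Definition at_centroid : {set T} :=
  [set j | [&& j \notin K0, top K0 j == r & (j == c) || (p j == c)]].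

Lemma size0_sub j : top K0 j = r -> size0 j <= size0 r.
Proof. by move=> <-; apply/subset_leq_card/below_sub_root. Qed.

Lemma key_double j : top K0 j = r -> (key j).*2 <= size0 r.
Proof. by move=> tj; rewrite /key tj; have := size0_sub tj; clear; lia. Qed.

Lemma key_gt0 j : j \notin K0 -> 0 < key j.
Proof.
move=> jK; rewrite leq_min card_gt0; apply/andP; split.
  by apply/set0Pn; exists j; apply: below_refl.
rewrite subn_gt0; apply/proper_card/properP; split; first exact: below_sub_root.
exists (top K0 j); first exact: below_refl.
apply/negP => h; have tj : top K0 j = j.
  by apply: (below_anti max0) => //; apply: below_top.
by move: jK; rewrite -tj top_in.
Qed.

Lemma key_child b : b \notin K0 -> p b = c -> key b = size0 b.
Proof.
move=> bK pb; have tb : top K0 b = r by rewrite -top_p // pb.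
by rewrite /key tb; have := c_light bK pb; clear; lia.
Qed.

Lemma key_c : key c = size0 r - size0 c.
Proof. by rewrite /key top_c; have := c_heavy; clear; lia. Qed.

(** [K] is a state in the middle of a sweep: since [K0], only edges at the centroid have been cut in
    the piece of [r]. *)
Variable K : {set T}.
Hypotheses (K0K : K0 \subset K)
  (K_at : forall j, j \in K -> j \notin K0 -> top K0 j = r -> j \in at_centroid).

Let maxK : ord_max \in K. Proof. exact: (subsetP K0K). Qed.
Let rK : r \in K. Proof. exact: (subsetP K0K). Qed.

(** No edge inside the branch of a child of [c] meets [c], so cuts at the centroid leave the branch
    whole. *)
Lemma below_intact b : b \notin K0 -> p b = c -> below K b = below K0 b.
Proof.
move=> bK0 pb; have tb : top K0 b = r by rewrite -top_p // pb.
have cb : c \notin below K0 b.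
  by apply/negP => /(below_le max0); have := lt_p max0 bK0; rewrite pb; lia.
apply/eqP; rewrite eqEsubset below_mono //=; apply/subsetP => x.
move: x; apply: (ascend_ind max0) => [x xK|x xK IH].
  by rewrite below_stop // => /eqP ->; apply: below_refl.
case: (eqVneq x b) => [-> _|xb]; first exact: below_refl.
move=> xinb; move: (xinb); rewrite below_step // (negbTE xb) /= => pxb.
have xnK : x \notin K.
  apply/negP => xK1; have tx : top K0 x = r by rewrite (top_below max0 xinb).
  have := K_at xK1 xK tx; rewrite inE => /and3P[_ _ /orP[/eqP xc|/eqP xc]].
    by move: cb; rewrite -xc xinb.
  by move: cb; rewrite -xc pxb.
by rewrite below_step // IH // orbT.
Qed.

(** An ascent that starts outside the subtree of [c] never uses an edge at [c], hence meets no new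
    cut. *)
Lemma top_outside x : top K0 x = r -> x \notin below K0 c -> top K x = r.
Proof.
move: x; apply: (ascend_ind max0) => [x xK|x xK IH].
  by rewrite top_fix // => -> _; rewrite top_fix.
move=> tx xc; have pxc : p x \notin below K0 c.
  by apply: contra xc => pxc; rewrite below_step // pxc orbT.
rewrite -top_p //; first by apply: IH => //; rewrite top_p.
apply/negP => xK1; have := K_at xK1 xK tx.
rewrite inE => /and3P[_ _ /orP[/eqP xc'|/eqP xc']].
  by move: xc; rewrite xc' below_refl.
by move: pxc; rewrite xc' below_refl.
Qed.

Lemma r_notin_c : c \notin K0 -> r \notin below K0 c.
Proof. by move=> cK; rewrite below_stop //; apply: contraNneq cK => <-. Qed.

Lemma top_centroid : top K c = if c \in K then c else r.
Proof.
case: (boolP (c \in K)) => cK; first by rewrite top_fix.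
have cK0 : c \notin K0 by apply: contra cK; apply: (subsetP K0K).
rewrite -top_p //; apply: top_outside; first by rewrite top_p.
by apply/negP => /(below_le max0); have := lt_p max0 cK0; clear; lia.
Qed.

(** While the upward edge of [c] is uncut, all new cuts of the piece lie inside the subtree of
    [c]. *)
Lemma outside_intact : c \notin K ->
  below K r :\: below K c = below K0 r :\: below K0 c.
Proof.
move=> cK; have cK0 : c \notin K0 by apply: contra cK; apply: (subsetP K0K).
apply/setP => x; rewrite !in_setD (below_root maxK _ rK) (below_root max0 _ rK0).
apply/andP/andP => [[xc /eqP xr]|[xc /eqP xr]]; split.
- apply/negP => /(below_walk max0 maxK)[xc'|]; first by rewrite xc' in xc.
  by rewrite xr (negbTE (r_notin_c cK0)).
- by rewrite -(top_mono x max0 K0K) xr top_fix.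
- by apply: contra xc; apply/subsetP/below_mono.
- by rewrite top_outside.
Qed.

Lemma key_max f : f \notin K -> top K f = top K c ->
  exists b, [/\ b \notin K, b \in at_centroid & key f <= key b].
Proof.
move=> fK tf; have fK0 : f \notin K0 by apply: contra fK; apply: (subsetP K0K).
have tf0 : top K0 f = r by rewrite -(top_mono f max0 K0K) tf top_mono.
case: (boolP ((f \in below K c) && (f != c))) => [/andP[fc nfc]|nfc].
  have [b [bK pb fb]] := below_child maxK fc nfc.
  have bK0 : b \notin K0 by apply: contra bK; apply: (subsetP K0K).
  exists b; split=> //.
    by rewrite inE bK0 -top_p // pb top_c !eqxx orbT.
  rewrite (key_child bK0 pb); apply: leq_trans (geq_minl _ _) _.
  apply/subset_leq_card/subsetP => x xf; apply: below_trans xf _.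
  by apply: (subsetP (below_mono _ max0 K0K)).
have cK : c \notin K.
  apply/negP => cK; move: nfc; rewrite below_root // tf top_fix // eqxx /=.
  by rewrite negbK => /eqP fc; rewrite fc cK in fK.
have cK0 : c \notin K0 by apply: contra cK; apply: (subsetP K0K).
exists c; split=> //; first by rewrite inE cK0 top_c !eqxx.
case: (eqVneq f c) => [->//|nf]; rewrite nf andbT in nfc.
have fc0 : f \notin below K0 c.
  apply/negP => /(below_walk max0 maxK)[fc|]; first by rewrite fc in nfc.
  by rewrite tf top_centroid (negbTE cK) (negbTE (r_notin_c cK0)).
rewrite key_c /key tf0; case: (boolP (c \in below K0 f)) => [cf|cf].
  have : size0 c <= size0 f.
    by apply/subset_leq_card/subsetP => x xc; apply: below_trans xc cf.
  move: c_heavy; clear; lia.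
have dis : below K0 f :&: below K0 c = set0.
  apply/eqP/set0Pn => -[x]; rewrite in_setI => /andP[xf xc].
  by have [h|h] := below_total max0 xf xc; [rewrite h in fc0 | rewrite h in cf].
have : size0 f + size0 c <= size0 r.
  rewrite /size0 -cardsUI dis cards0 addn0.
  by apply/subset_leq_card; rewrite subUset -{1}tf0 -top_c !below_sub_root.
clear; lia.
Qed.

Definition main_size := #|below K (top K c)|.

Lemma main_size_gt0 : 0 < main_size.
Proof. by rewrite card_gt0; apply/set0Pn; exists (top K c); apply: below_refl. Qed.

Lemma at_centroid_top j : j \notin K -> j \in at_centroid -> top K j = top K c.
Proof.
by move=> jK; rewrite inE => /and3P[_ _ /orP[/eqP ->|/eqP <-]]; rewrite ?top_p.
Qed.

(** Whether [c] is the lower or the upper end of the edge, the side away from [c] still has [key j]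
    vertices; being at most half, it is the smaller side. *)
Lemma max_sides j : j \notin K -> j \in at_centroid -> (key j).*2 <= main_size ->
  maxn #|below K j| (main_size - #|below K j|) = main_size - key j.
Proof.
move=> jK jc; have tj := at_centroid_top jK jc.
move: (jc); rewrite inE => /and3P[jK0 _ /orP[/eqP jE|/eqP pj]].
  subst j; have := outside_intact jK; have := top_centroid.
  rewrite (negbTE jK) => tc /(congr1 (fun A : {set T} => #|A|)).
  rewrite /main_size tc !cardsDS ?below_mono //; last first.
  - by rewrite -tc below_sub_root.
  - by rewrite -top_c below_sub_root.
  rewrite -!/(size0 _) -key_c.
  have : #|below K c| <= #|below K r| by rewrite -tc; apply/subset_leq_card/below_sub_root.
  clear; lia.
rewrite below_intact // (key_child jK0 pj) -/(size0 j); clear; lia.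
Qed.

(** The two sides of [f] in the current part are contained in its two sides at the start of the
    round, so the smaller one has at most [key f] vertices. *)
Lemma max_sides_ge f : f \notin K -> top K f = top K c ->
  main_size - key f <= maxn #|below K f| (main_size - #|below K f|).
Proof.
move=> fK tf; have fK0 : f \notin K0 by apply: contra fK; apply: (subsetP K0K).
have tf0 : top K0 f = r by rewrite -(top_mono f max0 K0K) tf top_mono.
have h1 : #|below K f| <= size0 f by apply/subset_leq_card/below_mono.
have fm : #|below K f| <= main_size.
  by rewrite /main_size -tf; apply/subset_leq_card/below_sub_root.
have h2 : main_size - #|below K f| <= size0 r - size0 f.
  rewrite /main_size /size0 -tf -tf0 -!cardsDS ?below_sub_root //.
  apply/subset_leq_card/subsetP => x; rewrite !in_setD => /andP[xf].
  rewrite (below_root maxK _ (top_in maxK f)) (below_root max0 _ (top_in max0 f)).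
  move=> /eqP tx.
  rewrite -(top_mono x max0 K0K) tx top_mono // eqxx andbT.
  apply/negP => /(below_walk max0 maxK)[h|]; first by rewrite h in xf.
  rewrite tx => /(below_le max0) h; have := below_le maxK (below_top K f) => h'.
  have e : top K f = f by apply/val_inj/anti_leq/andP.
  by move: fK; rewrite -e top_in.
by move: h1 h2 fm; rewrite /key tf0; clear; lia.
Qed.

(** A cut below [c] removes an intact branch; a cut above [c] makes [c] the root of what remains and
    removes the intact upper side. *)
Lemma main_size_cut j : j \notin K -> j \in at_centroid ->
  #|below (j |: K) (top (j |: K) c)| = main_size - key j.
Proof.
move=> jK jc; have tj := at_centroid_top jK jc.
have mK' : ord_max \in j |: K by rewrite inE maxK orbT.
move: (jc); rewrite inE => /and3P[jK0 _ /orP[/eqP jE|/eqP pj]].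
  subst j; rewrite top_fix ?inE ?eqxx // below_cut_self //.
  have := outside_intact jK; have := top_centroid.
  rewrite (negbTE jK) => tc /(congr1 (fun A : {set T} => #|A|)).
  rewrite /main_size tc !cardsDS ?below_mono //; last first.
  - by rewrite -tc below_sub_root.
  - by rewrite -top_c below_sub_root.
  rewrite -!/(size0 _) -key_c.
  have : #|below K c| <= #|below K r| by rewrite -tc; apply/subset_leq_card/below_sub_root.
  clear; lia.
have cj : c \notin below K j.
  by apply/negP => /(below_le maxK); have := lt_p max0 jK0; rewrite pj; lia.
rewrite top_cut // (negbTE cj) -tj below_cut_top // cardsDS ?below_sub_root //.
by rewrite /main_size tj (below_intact jK0 pj) (key_child jK0 pj).
Qed.

(** A part without the centroid lies within the branch of a child of [c] or within the upper side of
    [c], and neither exceeds half of the piece. *)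
Lemma side_small x : top K0 x = r -> top K x != top K c ->
  #|below K (top K x)|.*2 <= size0 r.
Proof.
move=> tx nx; case: (boolP (x \in below K0 c)) => xc.
  have nxc : x != c by apply: contraNneq nx => ->.
  have [b [bK0 pb xb]] := below_child max0 xc nxc.
  have bK : b \in K.
    apply: contraR nx => bK; rewrite -(below_intact bK0 pb) in xb.
    by rewrite (top_below maxK xb) -pb top_p.
  apply: leq_trans (c_light bK0 pb); rewrite leq_double.
  apply: leq_trans (subset_leq_card (below_mono _ max0 K0K)) _.
  apply/subset_leq_card/subsetP => y yx; apply: below_trans yx _.
  have [|//] := below_walk max0 maxK xb.
  by rewrite below_root // => /eqP ->; apply: below_refl.
have tr := top_outside tx xc; rewrite tr in nx *.
have cK : c \in K by apply: contraR nx => cK; rewrite top_centroid (negbTE cK).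
rewrite (top_fix cK) in nx.
suff : #|below K r| <= size0 r - size0 c by move: c_heavy; clear; lia.
rewrite /size0 -cardsDS; last by rewrite -top_c below_sub_root.
apply/subset_leq_card/subsetP => y.
rewrite in_setD (below_root maxK _ rK) (below_root max0 _ rK0) => /eqP ty.
rewrite -(top_mono y max0 K0K) ty top_fix // eqxx andbT.
apply/negP => /(below_walk max0 maxK)[|].
  by rewrite below_root // ty (negbTE nx).
by rewrite ty below_stop // (negbTE nx).
Qed.

(** An edge left in the part would lead, by [key_max], to an uncut edge at [c]. *)
Lemma main_size_done : at_centroid \subset K -> main_size <= 1.
Proof.
move=> sub; rewrite -(cards1 (top K c)); apply/subset_leq_card/subsetP => x.
rewrite below_root ?top_in // inE => /eqP tx; case: (boolP (x \in K)) => xK.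
  by rewrite -tx top_fix.
by have [b [bK /(subsetP sub)]] := key_max xK tx; rewrite (negbTE bK).
Qed.

End Centroid.
End Forest.

(** * Pieces of a tree *)

Section Pieces.

Variables (N : nat) (p q : 'I_N.+1 -> 'I_N.+1) (G : graph 'I_N.+1).
Local Notation T := 'I_N.+1.
Local Notation below := (below p).
Local Notation top := (top p).
Definition link (j : T) : {set T} := [set q j; q (p j)].

Hypothesis p_gt : forall j : T, j != ord_max -> j < p j.
Hypothesis q_inj : injective q.
Hypothesis vertsG : verts G = [set: T].
Hypothesis edgesG : edges G = link @: [set~ ord_max].

(** The position [j] is recovered as the lower-numbered end of its edge. *)
Lemma link_inj i j : i != ord_max -> j != ord_max -> link i = link j -> i = j.
Proof.
move=> im jm e; have := p_gt im; have := p_gt jm.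
have : q i \in link j by rewrite -e !inE eqxx.
have : q j \in link i by rewrite e !inE eqxx.
rewrite !inE !(inj_eq q_inj) => /orP[/eqP ->//|/eqP ji] /orP[/eqP ->//|/eqP ij].
by rewrite -ji -ij; lia.
Qed.

Definition piece (K : {set T}) (r : T) : graph T := induced G (q @: below K r).

Lemma card_image (A : {set T}) : #|q @: A| = #|A|.
Proof. exact: card_imset. Qed.

Lemma piece_root : piece [set ord_max] ord_max = G.
Proof.
have bT : below [set ord_max] ord_max = [set: T].
  apply/setP=> x; rewrite below_root ?inE //.
  by have := top_in p_gt (set11 ord_max) x; rewrite inE.
rewrite /piece /induced bT (_ : q @: [set: T] = [set: T]).
  case: G vertsG => V E /= ->; congr Graph; apply/setP=> e.
  by rewrite !inE subsetT andbT.
by apply/eqP; rewrite eqEcard subsetT card_imset ?leqnn.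
Qed.

Section OnePiece.

Variables (K : {set T}) (r : T).
Hypotheses (maxK : ord_max \in K) (rK : r \in K).

Lemma piece_edge f : f \notin K -> top K f = r -> link f \in edges (piece K r).
Proof.
move=> fK tf; rewrite inE edgesG; apply/andP; split.
  by apply: imset_f; rewrite !inE (notin_neq_max maxK).
apply/subsetP => v; rewrite !inE => /orP[/eqP ->|/eqP ->]; apply: imset_f.
  by rewrite below_root // tf.
by rewrite below_root // top_p // tf.
Qed.

Lemma piece_edgeP e : e \in edges (piece K r) ->
  exists f, [/\ f \notin K, top K f = r & e = link f].
Proof.
rewrite inE edgesG => /andP[/imsetP[f]]; rewrite !inE => fm -> sub; exists f.
have fr : f \in below K r.
  have /imsetP[x xr /q_inj -> //] : q f \in q @: below K r.
  by apply: (subsetP sub); rewrite !inE eqxx.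
have pr : p f \in below K r.
  have /imsetP[x xr /q_inj -> //] : q (p f) \in q @: below K r.
  by apply: (subsetP sub); rewrite !inE eqxx orbT.
split=> //; last by apply/eqP; rewrite -below_root.
apply/negP => fK; have := p_gt fm; move: fr (below_le p_gt maxK pr).
by rewrite below_stop // => /eqP ->; lia.
Qed.

Variable j : T.
Hypotheses (jK : j \notin K) (topj : top K j = r).
Let K' := j |: K.
Let H' := delete_edge (piece K r) (link j).

Let maxK' : ord_max \in K'. Proof. by rewrite !inE maxK orbT. Qed.
Let jm : j != ord_max. Proof. exact: (notin_neq_max maxK jK). Qed.

Lemma adj_sym (H : graph T) : connect_sym (adj H).
Proof. by apply: sym_connect_sym => x y; rewrite /adj /= setUC. Qed.

Lemma cut_edgeP e : e \in edges H' ->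
  exists f, [/\ f \notin K', top K' f = top K' (p f), e = link f & f \in below K r].
Proof.
rewrite in_setD1 => /andP[ne /piece_edgeP[f [fK tf eE]]].
have fK' : f \notin K'.
  by rewrite !inE negb_or fK andbT; apply: contraNneq ne => fj; rewrite eE fj.
by exists f; split=> //; rewrite ?top_p // below_root // tf.
Qed.

(** The root [top K'] is constant along the remaining edges; conversely, its ascent connects every
    position to its root. *)
Lemma connect_cut x y : x \in below K r -> y \in below K r ->
  connect (adj H') (q x) (q y) = (top K' x == top K' y).
Proof.
move=> xr yr; apply/idP/eqP => [|txy].
  pose lab v := top K' (invF q_inj v).
  have lab_adj u v : adj H' u v -> lab u = lab v.
    move=> /cut_edgeP[f [_ tf eE _]].
    have hu : u \in link f by rewrite -eE !inE eqxx.
    have hv : v \in link f by rewrite -eE !inE eqxx orbT.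
    by move: hu hv; rewrite !inE /lab => /orP[/eqP->|/eqP->] /orP[/eqP->|/eqP->];
      rewrite !invF_f.
  rewrite -[in RHS](invF_f q_inj y) -[in LHS](invF_f q_inj x) -!/(lab _).
  case/connectP => s; elim: s (q x) => [u _ ->//|v s IH u] /= /andP[uv pth] lst.
  by rewrite (lab_adj _ _ uv); apply: IH.
suff up z : z \in below K r -> connect (adj H') (q z) (q (top K' z)).
  by apply: connect_trans (up _ xr) _; rewrite adj_sym txy; apply: up.
move: z; apply: (ascend_ind p_gt maxK') => [z zK' _|z zK' IH zr].
  by rewrite top_fix // connect0.
rewrite -top_p //; move: (zK'); rewrite !inE negb_or => /andP[zj zK].
have tz : top K z = r by apply/eqP; rewrite -below_root.
apply: connect_trans (IH _); last by rewrite below_root // top_p // tz.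
apply/connect1; rewrite /adj /= in_setD1 piece_edge // andbT.
by apply: contraNneq zj => /link_inj -> //; apply: (notin_neq_max maxK').
Qed.

Lemma below_cut_r : below K' r = below K r :\: below K j.
Proof. by rewrite -topj below_cut_top. Qed.

Lemma components_cut :
  components H' = [set q @: below K' j; q @: below K' r].
Proof.
have jK' : j \in K' by rewrite !inE eqxx.
have rK' : r \in K' by rewrite !inE rK orbT.
have subK z : z \in K' -> z \in below K r -> below K' z \subset below K r.
  move=> zK' zr; apply: subset_trans (below_mono p_gt _ maxK (subsetU1 _ _)) _.
  by apply/subsetP => x xz; apply: below_trans xz zr.
have jr : j \in below K r by rewrite below_root // topj.
have classE x : x \in below K r ->
    [set v in q @: below K r | connect (adj H') (q x) v] = q @: below K' (top K' x).
  move=> xr; apply/setP=> v; rewrite inE; apply/andP/imsetP.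
    move=> [/imsetP[y yr ->]]; rewrite connect_cut // => /eqP txy.
    by exists y => //; rewrite below_root ?top_in // txy.
  move=> [y yx ->]; have tx : top K' x \in below K r.
    rewrite top_cut //; case: ifP => // _.
    by have := xr; rewrite {1}(below_root p_gt maxK x rK) => /eqP ->; apply: below_refl.
  have yr : y \in below K r by apply: (subsetP (subK _ _ tx)) yx; apply: top_in.
  split; first exact: imset_f.
  by move: yx; rewrite connect_cut // below_root ?top_in // eq_sym.
have partE z : z \in K' -> z \in below K r ->
    q @: below K' z = [set v in q @: below K r | connect (adj H') (q z) v].
  by move=> zK' zr; rewrite classE // top_fix.
rewrite /components /equivalence_partition /=; apply/setP=> C; rewrite !inE.
apply/imsetP/orP => [[v /imsetP[x xr ->] ->]|[/eqP->|/eqP->]].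
- rewrite classE // top_cut //; case: ifP => _; first by left.
  by right; move: xr; rewrite (below_root p_gt maxK x rK) => /eqP ->.
- by exists (q j); [exact: imset_f | rewrite partE].
- by exists (q r); [exact/imset_f/below_refl | rewrite partE ?below_refl].
Qed.

Lemma cut_parts_neq : q @: below K' j != q @: below K' r.
Proof.
apply/negP => /eqP/setP/(_ (q j)); rewrite imset_f ?below_refl //.
move/esym/imsetP => [x xr /q_inj jx]; move: xr; rewrite -jx below_cut_r.
by rewrite in_setD below_refl.
Qed.

Lemma largest_cut : largest_component (piece K r) (link j) =
  maxn #|below K j| (#|below K r| - #|below K j|).
Proof.
rewrite /largest_component components_cut big_setU1 ?inE ?cut_parts_neq //=.
rewrite big_set1 !card_image below_cut_self // below_cut_r cardsDS //.
by rewrite -topj below_sub_root.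
Qed.

Lemma induced_cut z : z \in K' -> z = j \/ z = r ->
  induced H' (q @: below K' z) = piece K' z.
Proof.
move=> zK' zjr; congr Graph; apply/setP=> e.
rewrite inE [in RHS]inE in_setD1 inE.
case: (boolP (e \subset q @: below K' z)) => sub; rewrite ?andbF // !andbT.
have -> : e \subset q @: below K r.
  apply: subset_trans sub _; apply: imsetS.
  apply: subset_trans (below_mono p_gt _ maxK (subsetU1 _ _)) _.
  by case: zjr => ->; rewrite // -topj below_sub_root.
rewrite andbT andb_idl // => _; apply: contraTneq sub => ->.
apply/negP => sub.
have /imsetP[x xz /q_inj jx] : q j \in q @: below K' z.
  by apply: (subsetP sub); rewrite !inE eqxx.
have /imsetP[y yz /q_inj pjy] : q (p j) \in q @: below K' z.
  by apply: (subsetP sub); rewrite !inE eqxx orbT.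
move: xz; rewrite -jx below_stop ?inE ?eqxx // => /eqP jz.
move: yz; rewrite -pjy -jz => /(below_le p_gt maxK'); have := p_gt jm; lia.
Qed.

End OnePiece.

Lemma balanced_cut (K : {set T}) (r j : T) : ord_max \in K -> r \in K -> j \notin K -> top K j = r ->
  (forall f, f \notin K -> top K f = r ->
     maxn #|below K j| (#|below K r| - #|below K j|) <=
     maxn #|below K f| (#|below K r| - #|below K f|)) ->
  balanced (piece K r) (link j).
Proof.
move=> maxK rK jK tj h; split; first exact: piece_edge.
move=> e /(piece_edgeP maxK rK)[f [fK tf ->]].
by rewrite !largest_cut //; apply: h.
Qed.

(** The side of [j] becomes the first child and the side of the old root the second; the output
    cells follow this order. *)
Lemma balanced_node (K : {set T}) (r j : T) t1 t2 :
  ord_max \in K -> r \in K -> j \notin K -> top K j = r ->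
  balanced (piece K r) (link j) ->
  balanced_ept (piece (j |: K) j) t1 -> balanced_ept (piece (j |: K) r) t2 ->
  balanced_ept (piece K r) (Node (link j) t1 t2).
Proof.
move=> maxK rK jK tj bal b1 b2.
apply: (ept_node bal (cut_parts_neq maxK jK tj) (components_cut maxK rK jK tj)).
  by rewrite induced_cut // ?inE ?eqxx //; left.
by rewrite induced_cut // ?inE ?rK ?orbT //; right.
Qed.

Lemma balanced_leaf (r : T) : balanced_ept (piece [set: T] r) (Leaf (q r)).
Proof.
apply: ept_leaf => /=; rewrite (_ : below _ _ = [set r]) ?imset_set1 //.
by apply/setP=> x; rewrite below_stop ?inE.
Qed.

End Pieces.

(** * Attaching pieces to the output *)

(** Arrays 0 to 3 are input and output. [DEG], [SUM]: remaining degree of a vertex and sum of the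
    indices of its remaining edges. [ORD], [POS]: vertex at a position, position of a vertex. [UP],
    [EID], [PAR]: parent vertex, edge index and parent position of a position. [CUT]: membership in
    [K]. [SZ], [TOP]: subtree size and root. [CEN], [CUR]: centroid of a root's piece and current
    size of the part around it. [HEAD], [NEXT]: buckets. [SLOT], [SIDE]: index and array of the
    output cell that waits for a root's piece. *)
Notation DEG := 4 (only parsing).
Notation SUM := 5 (only parsing).
Notation ORD := 6 (only parsing).
Notation POS := 7 (only parsing).
Notation UP := 8 (only parsing).
Notation EID := 9 (only parsing).
Notation PAR := 10 (only parsing).
Notation CUT := 11 (only parsing).
Notation SZ := 12 (only parsing).
Notation TOP := 13 (only parsing).
Notation CEN := 14 (only parsing).
Notation HEAD := 15 (only parsing).
Notation NEXT := 16 (only parsing).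
Notation CUR := 17 (only parsing).
Notation SLOT := 18 (only parsing).
Notation SIDE := 19 (only parsing).

Section Assembly.

Variables (N : nat) (p q : 'I_N.+1 -> 'I_N.+1) (G : graph 'I_N.+1).
Variables (es : seq ('I_N.+1 * 'I_N.+1)) (eid : 'I_N.+1 -> nat).
Local Notation T := 'I_N.+1.
Local Notation n := N.+1.

Implicit Types (K : {set T}) (j r : T) (s : state).

Hypothesis p_gt : forall j : T, j != ord_max -> j < p j.
Hypothesis q_inj : injective q.
Hypothesis vertsG : verts G = [set: T].
Hypothesis edgesG : edges G = link p q @: [set~ ord_max].
Hypothesis eid_lt : forall j : T, j != ord_max -> eid j < n.
Hypothesis eid_inj : forall i j : T, i != ord_max -> j != ord_max -> eid i = eid j -> i = j.
Hypothesis eid_link : forall j : T, j != ord_max ->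
  onth [seq edge_of e | e <- es] (eid j) = Some (link p q j).

Definition cell (s : state) (r : T) : nat * nat :=
  (if arr s SIDE r == 0 then 2 else 3, arr s SLOT r).

(** Index [n] is a sentinel: cell [n] of array 2 receives the root of the whole tree. Edge indices
    are below [n], so no node uses it. *)
Definition used (K : {set T}) (i : nat) : Prop :=
  i = n \/ exists2 j : T, j \in K :\ ord_max & i = eid j.

(* [cell s r] is where the tree of the piece with root [r] is still to be
   attached. Whatever trees the pieces turn out to have, filling in these cells
   completes the tree of [G], provided that no cell filled before is changed. *)
Definition assembly (K : {set T}) (s : state) : Prop :=
  [/\ forall r, r \in K -> used K (arr s SLOT r),
      {in K &, injective (cell s)} &
      forall s' (t_ : T -> ept T),
        (forall b i, b \in [:: 2; 3] -> used K i ->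
           (forall r, r \in K -> cell s r <> (b, i)) -> arr s' b i = arr s b i) ->
        (forall r, r \in K -> balanced_ept (piece p q G K r) (t_ r) /\
           outputs es s' (arr s' (cell s r).1 (cell s r).2) (t_ r)) ->
        exists B, balanced_ept G B /\ outputs es s' (arr s' 2 n) B].

Lemma assembly_ext K s s1 :
  (forall a, a \in [:: 2; 3; SLOT; SIDE] -> arr s1 a =1 arr s a) ->
  assembly K s -> assembly K s1.
Proof.
move=> e [us inj fill]; have ce r : cell s1 r = cell s r by rewrite /cell !e.
split.
- by move=> r; rewrite e //; apply: us.
- by move=> r r'; rewrite !ce; apply: inj.
- move=> s' t_ same trees; apply: (fill s' t_) => [b i hb ui pend|r rK].
    rewrite same //; first by apply: e; move: hb; rewrite !inE => /orP[] /eqP ->.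
    by move=> r; rewrite ce; apply: pend.
  by rewrite -ce; apply: trees.
Qed.

Lemma assembly_set_arr K s a i v : a \notin [:: 2; 3; SLOT; SIDE] ->
  assembly K s -> assembly K (set_arr s a i v).
Proof.
move=> na; apply: assembly_ext => b hb k /=; case: eqP => //= ba.
by rewrite -ba hb in na.
Qed.

Lemma assembly_init s :
  arr s SLOT N = n -> arr s SIDE N = 0 -> assembly [set ord_max] s.
Proof.
move=> sl sd; split.
- by move=> r; rewrite inE => /eqP ->; left.
- by move=> r r'; rewrite !inE => /eqP -> /eqP ->.
- move=> s' t_ _ /(_ ord_max (set11 _)); rewrite /cell /= sl sd /=.
  by rewrite piece_root // => -[b o]; exists (t_ ord_max).
Qed.

(** The waiting cell of the cut piece receives the new node, and the two child cells of this node
    become the waiting cells of the two parts. Given trees for the new pieces, joining those of [j]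
    and of the old root yields trees for the old pieces. *)
Lemma assembly_cut K s s1 j :
  ord_max \in K -> j \notin K ->
  balanced (piece p q G K (top p K j)) (link p q j) ->
  (forall b i, b \in [:: 2; 3] -> arr s1 b i =
     if (b, i) == cell s (top p K j) then n + eid j else arr s b i) ->
  (forall r : T, arr s1 SLOT r =
     if (r == j) || (r == top p K j) then eid j else arr s SLOT r) ->
  (forall r : T, arr s1 SIDE r =
     if r == top p K j then 1 else if r == j then 0 else arr s SIDE r) ->
  assembly K s -> assembly (j |: K) s1.
Proof.
set R := top p K j => mK jK bal sout sslot sside [us inj fill].
have RK : R \in K by apply: top_in.
have jm : j != ord_max by apply: notin_neq_max jK.
have jR : j != R by apply: contraNneq jK => ->.
(* Indices in use are the sentinel or belong to edges cut earlier. *)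
have fresh r : r \in K -> arr s SLOT r <> eid j.
  move=> /us[-> h|[i]]; first by have := eid_lt jm; rewrite h ltnn.
  rewrite !inE => /andP[im iK] -> /(eid_inj im jm) ij; by rewrite -ij iK in jK.
have cellj : cell s1 j = (2, eid j).
  by rewrite /cell sside sslot (negbTE jR) eqxx.
have cellR : cell s1 R = (3, eid j).
  by rewrite /cell sside sslot !eqxx orbT.
have cellr r : r \in K -> r != R -> cell s1 r = cell s r.
  move=> rK rR; have rj : r != j by apply: contraNneq jK => <-.
  by rewrite /cell sside sslot (negbTE rR) (negbTE rj).
have used_mono i : used K i -> used (j |: K) i.
  case=> [->|[k kK ->]]; first by left.
  by right; exists k => //; move: kK; rewrite !inE => /andP[-> ->]; rewrite orbT.
have used_j : used (j |: K) (eid j) by right; exists j; rewrite ?inE ?jm ?eqxx.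
have cell_fresh r b : r \in K -> cell s r <> (b, eid j).
  by move=> rK [_]; apply: fresh.
split.
- move=> r; rewrite in_setU1 sslot => /orP[/eqP ->|rK]; first by rewrite eqxx.
  by case: ifP => // _; apply/used_mono/us.
- have cellK r : r \in K -> cell s1 r = (3, eid j) /\ r = R \/ cell s1 r = cell s r /\ r != R.
    by move=> rK; case: (eqVneq r R) => [->|rR]; [left | right; rewrite cellr].
  move=> r r'; rewrite !in_setU1 => /orP[/eqP ->|rK] /orP[/eqP ->|r'K] //.
  + rewrite cellj; case: (cellK _ r'K) => -[-> _] // h.
    by case: (cell_fresh _ _ r'K (esym h)).
  + rewrite cellj; case: (cellK _ rK) => -[-> _] // h.
    by case: (cell_fresh _ _ rK h).
  + case: (cellK _ rK) => -[-> h1]; case: (cellK _ r'K) => -[-> h2] h.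
    * by rewrite h1 h2.
    * by case: (cell_fresh _ _ r'K (esym h)).
    * by case: (cell_fresh _ _ rK h).
    * exact: inj.
- move=> s' t_ same trees.
  apply: (fill s' (fun r => if r == R then Node (link p q j) (t_ j) (t_ R) else t_ r)).
    move=> b i bb ui pend.
    have bi : (b, i) == cell s R = false by apply/negP => /eqP e; apply: (pend R).
    rewrite same //; [by rewrite sout // bi | exact: used_mono |].
    have ij : eid j <> i.
      case: ui => [->|[k]]; first by move=> h; have := eid_lt jm; rewrite h ltnn.
      rewrite !inE => /andP[km kK] -> /(eid_inj jm km) kj; by rewrite kj kK in jK.
    move=> r; rewrite in_setU1 => /orP[/eqP ->|rK]; first by rewrite cellj => -[_].
    case: (eqVneq r R) => [->|rR]; first by rewrite cellR => -[_].
    by rewrite cellr //; apply: pend.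
  move=> r rK; case: eqP => [->|/eqP rR]; last first.
    have := trees r; rewrite in_setU1 rK orbT => /(_ isT) [bt ot].
    rewrite -(cellr _ rK rR); split=> //.
    by move: bt; rewrite /piece below_cut_other.
  have [bj oj] := trees j (setU11 _ _).
  have [bR oR] := trees R (setU1r _ RK).
  split; first exact: balanced_node.
  have inb : (cell s R).1 \in [:: 2; 3] by rewrite /cell /=; case: ifP.
  have pend r' : r' \in j |: K -> cell s1 r' <> ((cell s R).1, (cell s R).2).
    rewrite -surjective_pairing in_setU1 => /orP[/eqP ->|rK'].
      by rewrite cellj => /esym/(cell_fresh _ _ RK).
    case: (eqVneq r' R) => [->|rR].
      by rewrite cellR => /esym/(cell_fresh _ _ RK).
    by rewrite cellr // => /(inj _ _ rK' RK) e; rewrite e eqxx in rR.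
  have -> : arr s' (cell s R).1 (cell s R).2 = n + eid j.
    rewrite same //; first by rewrite sout // -surjective_pairing eqxx.
    exact/used_mono/us.
  exists (eid j); split=> //; first exact: eid_link.
    by move: oj; rewrite cellj.
  by move: oR; rewrite cellR.
Qed.

Lemma assembly_done s s' : assembly [set: T] s ->
  (forall b i, b \in [:: 2; 3] -> (forall r, cell s r <> (b, i)) -> arr s' b i = arr s b i) ->
  (forall r, arr s' (cell s r).1 (cell s r).2 = q r) ->
  exists B, balanced_ept G B /\ outputs es s' (arr s' 2 n) B.
Proof.
move=> [_ _ fill] same done; apply: (fill s' (fun r => Leaf (q r))).
  by move=> b i bb _ pend; apply: same => // r; apply: pend; rewrite inE.
by move=> r _; split; [exact: balanced_leaf | rewrite done].
Qed.

End Assembly.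

(** * Sizes, roots, centroids and buckets *)

Notation "p ';;' q" := (Seq p q) (at level 60, right associativity).

Definition reset_loop : prog :=
  For 1 (Put SZ (Reg 1) (Lit 1) ;; Put HEAD (Reg 1) (Lit 0)).

(** Children precede their parents, so in an increasing scan each size is complete when it is passed
    on. *)
Definition size_loop : prog :=
  For 1 (If (Get CUT (Reg 1)) Skip (
    SetReg 2 (Get PAR (Reg 1)) ;;
    Put SZ (Reg 2) (Bin Add (Get SZ (Reg 2)) (Get SZ (Reg 1))))).

(** A decreasing scan, in which the parent already knows its root. Each heavy position overwrites
    [CEN] of its root, so the lowest one survives. *)
Definition top_loop : prog :=
  For 1 (
    SetReg 2 (Bin Defs.Sub (Bin Defs.Sub (Reg 0) (Lit 1)) (Reg 1)) ;;
    If (Get CUT (Reg 2)) (SetReg 3 (Reg 2)) (SetReg 3 (Get TOP (Get PAR (Reg 2)))) ;;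
    Put TOP (Reg 2) (Reg 3) ;;
    Put CUR (Reg 2) (Get SZ (Reg 2)) ;;
    If (Bin Less (Get SZ (Reg 3)) (Bin Add (Get SZ (Reg 2)) (Get SZ (Reg 2))))
      (Put CEN (Reg 3) (Reg 2)) Skip).

(** The sum of the two tests is a disjunction. List entries are positions plus one, which leaves [0]
    for the end of a list. *)
Definition bucket_loop : prog :=
  For 1 (If (Get CUT (Reg 1)) Skip (
    SetReg 2 (Get TOP (Reg 1)) ;;
    SetReg 3 (Get CEN (Reg 2)) ;;
    If (Bin Add (Bin Equal (Reg 1) (Reg 3)) (Bin Equal (Get PAR (Reg 1)) (Reg 3))) (
      SetReg 4 (Get SZ (Reg 1)) ;;
      SetReg 5 (Bin Defs.Sub (Get SZ (Reg 2)) (Reg 4)) ;;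
      If (Bin Less (Reg 5) (Reg 4)) (SetReg 4 (Reg 5)) Skip ;;
      Put NEXT (Reg 1) (Get HEAD (Reg 4)) ;;
      Put HEAD (Reg 4) (Bin Add (Reg 1) (Lit 1))) Skip)).

Section Loops.

Variables (w X N : nat) (p q : 'I_N.+1 -> 'I_N.+1) (eid : 'I_N.+1 -> nat).
Local Notation T := 'I_N.+1.
Local Notation n := N.+1.
Implicit Types (K : {set T}) (j r c : T) (s : state).

Hypothesis p_gt : forall j : T, j != ord_max -> j < p j.
Hypothesis wX : 64 * X < 2 ^ w.
Hypothesis nX : n.+2 * n.+2 <= X.

Let ltnX : n < X. Proof. nia. Qed.

Definition tree_mem s : Prop :=
  [/\ forall j, arr s ORD j = q j,
      forall j, j != ord_max -> arr s PAR j = p j &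
      forall j, j != ord_max -> arr s EID j = eid j].

Definition cut_mem K s : Prop := forall j, arr s CUT j = (j \in K).

Definition size_mem K s : Prop := forall j, arr s SZ j = #|below p K j|.

(** The 100 bounds the duration of every [For] body in the program. *)
Definition loop_time := for_time n 100.

Lemma reset_loop_runs s : bounded X s -> reg s 0 = n ->
  runs w X reset_loop s loop_time
    (fun s' => (forall j, arr s' SZ j = 1 /\ arr s' HEAD j = 0)
       /\ same_off reset_loop s s').
Proof.
move=> bs r0.
pose I k s := forall j, j < k -> arr s SZ j = 1 /\ arr s HEAD j = 0.
apply: runs_weaken (leqnn _) _.
  apply: (@runs_for_wp w X n 1 _ _ I) => //.
  move=> k s1 kn bs1 _ rk Ik /= j; rewrite ltnS rk leq_eqVlt /=.
  by case: (nat_of_ord j == k) => //= jk; apply: Ik.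
by move=> s' _ [h so]; split=> // j; apply: h.
Qed.

Lemma below_all_cut K j : K = [set: T] -> below p K j = [set j].
Proof. by move=> ->; apply/setP=> x; rewrite below_stop ?inE. Qed.

Lemma size_loop_runs K s : bounded X s -> reg s 0 = n -> ord_max \in K ->
  tree_mem s -> cut_mem K s -> (forall j, arr s SZ j = 1) ->
  runs w X size_loop s loop_time
    (fun s' => size_mem K s' /\ same_off size_loop s s').
Proof.
move=> bs r0 mK tm cm sz1.
(* The edges that the loop has still to treat count as deleted. *)
pose U k : {set T} := K :|: [set i | k <= val i].
have mU k : ord_max \in U k by rewrite inE mK.
pose I k s := [/\ tree_mem s, cut_mem K s & size_mem (U k) s].
apply: runs_weaken (leqnn _) _.
  apply: (@runs_for_wp w X n 1 _ _ I) => //.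
    move=> k s1 kn bs1 r0' rk [tm1 cm1 sm1] /=.
    pose j := Ordinal kn; rewrite rk.
    have UE : U k = j |: U k.+1.
      by apply/setP=> i; rewrite !inE -val_eqE /= leq_eqVlt [k == _]eq_sym orbCA.
    rewrite -[k]/(val j) (cm1 j); case: (boolP (j \in K)) => jK /=.
      split=> //; move=> i; rewrite sm1 UE.
      by congr #|below p _ i|; apply/setUidPr; rewrite sub1set inE jK.
    have jU : j \notin U k.+1 by rewrite !inE negb_or jK /= ltnn.
    have jm := notin_neq_max mK jK.
    case: (tm1) => [o1 p1 e1]; move=> v; rewrite -[k]/(val j) p1 // => ->.
    (* The parent comes later than [j], so it still counts as a root, and restoring the edge of [j]
       enlarges no other subtree. *)
    have pU : p j \in U k.+1 by rewrite !inE (p_gt jm) orbT.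
    have tj : top p (U k.+1) j = p j by rewrite -top_p // top_fix.
    have szp : #|below p (U k.+1) (p j)| = arr s1 SZ (p j) + arr s1 SZ j.
      rewrite !sm1 UE below_cut_self // -tj below_cut_top //.
      by rewrite cardsDS ?below_sub_root // subnK // subset_leq_card ?below_sub_root.
    rewrite -szp; split.
      by apply: leq_trans (max_card _) _; rewrite card_ord; apply: ltnW.
    split=> // i /=; case: eqP => [/val_inj ->|/eqP ip] //.
    rewrite sm1 UE below_cut //; case: ifP => // /andP[ji ij].
    move: ji; rewrite (below_step p _ jU) eq_sym (negbTE ij) (below_stop p _ pU).
    by move=> /eqP pi; rewrite -pi eqxx in ip.
  split=> // j; rewrite sz1 below_all_cut ?cards1 //.
  by apply/setP=> i; rewrite !inE orbT.
move=> s' _ [[_ _ h] so]; split=> // j; rewrite h; congr #|below p _ j|.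
apply/setP=> i; rewrite !inE leqNgt ltn_ord orbF //.
Qed.

(* The centroid recorded for a root is the least heavy position of its piece:
   positions increase upwards, so all the children of that one are light. *)
Definition centroid_mem K k s : Prop := forall r, r \in K -> n <= r + k ->
  exists c, [/\ arr s CEN r = c, n <= c + k, top p K c = r,
    #|below p K r| < (#|below p K c|).*2 &
    forall j, n <= j + k -> top p K j = r ->
      #|below p K r| < (#|below p K j|).*2 -> c <= j].

Definition top_mem K k s : Prop := forall j, n <= j + k ->
  arr s TOP j = top p K j /\ arr s CUR j = #|below p K j|.

Lemma top_loop_runs K s : bounded X s -> reg s 0 = n -> ord_max \in K ->
  tree_mem s -> cut_mem K s -> size_mem K s ->
  runs w X top_loop s loop_time
    (fun s' => top_mem K n s' /\ centroid_mem K n s' /\ same_off top_loop s s').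
Proof.
move=> bs r0 mK tm cm sm.
pose I k s := [/\ tree_mem s, cut_mem K s, size_mem K s, top_mem K k s & centroid_mem K k s].
apply: runs_weaken (leqnn _) _.
  apply: (@runs_for_wp w X n 1 _ _ I) => //.
    move=> k s1 kn bs1 r0' rk [tm1 cm1 sm1 top1 cen1] /=.
    move=> v; rewrite r0' rk => vE.
    have vn : v < n by move: vE kn; clear; lia.
    pose j := Ordinal vn; have jE : n = j + k.+1 by rewrite /=; move: vE kn; clear; lia.
    have v2 (i : T) : n <= i + k.+1 -> n <= i + k \/ i = j.
      move=> h; have [ij|ij] := eqVneq i j; first by right.
      left; move: h jE ij; rewrite -val_eqE /=; clear; lia.
    have jnew : n <= j + k = false by move: jE; clear; lia.
    clear vE; rewrite -[v]/(val j) (cm1 j).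
    (* Both branches of the conditional continue with the same commands, treated here once for the
       value [R] of register 3. *)
    have setr (R : nat) : R = top p K j ->
      wp X (Put TOP (Reg 2) (Reg 3) ;;
            Put CUR (Reg 2) (Get SZ (Reg 2)) ;;
            If (Bin Less (Get SZ (Reg 3)) (Bin Add (Get SZ (Reg 2)) (Get SZ (Reg 2))))
              (Put CEN (Reg 3) (Reg 2)) Skip) (I k.+1)
        (set_reg (set_reg s1 2 j) 3 R).
      move=> -> /=; rewrite -[v]/(val j) !(sm1 _) addnn.
      have topk s2 : (forall i : T, arr s2 TOP i = if i == j then val (top p K j) else arr s1 TOP i) ->
          (forall i : T, arr s2 CUR i = if i == j then #|below p K j| else arr s1 CUR i) ->
          top_mem K k.+1 s2.
        move=> h1 h2 i /v2[hi|->]; last by rewrite h1 h2 eqxx.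
        have ij : i != j by apply: contraTneq hi => ->; rewrite jnew.
        by rewrite h1 h2 (negbTE ij); apply: top1.
      case: ifP => h; split=> //.
      + apply: topk => i /=; rewrite -?val_eqE //.
      + move=> r rK /v2[hr|rj].
          have [c [cr nc tc hc mc]] := cen1 r rK hr.
          case: (eqVneq (top p K j) r) => tj.
            exists j; rewrite /= tj eqxx -tj; split=> //.
            - by rewrite jE.
            - by move: h; case: ltnP.
            - by move=> i hi _ _; change (j <= i); move: hi jE; clear; lia.
          exists c; rewrite /= val_eqE eq_sym (negbTE tj); split=> //.
            by rewrite addnS ltnW.
          move=> i /v2[|->]; first exact: mc.
          by move=> e; rewrite e eqxx in tj.
        rewrite rj in rK *; have tj : top p K j = j by rewrite top_fix.
        exists j; rewrite /= tj eqxx; split=> //.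
        - by rewrite jE.
        - by move: h; rewrite tj; case: ltnP.
        - by move=> i hi _ _; change (j <= i); move: hi jE; clear; lia.
      + by apply: topk => i /=; rewrite -?val_eqE.
      + move: h => /negbT; rewrite negbK; case: ltnP => // h _.
        move=> r rK /v2[hr|rj].
          have [c [cr nc tc hc mc]] := cen1 r rK hr.
          exists c; split=> //; first by rewrite addnS ltnW.
          move=> i /v2[|->]; first exact: mc.
          by move=> e; rewrite -e ltnNge h.
        (* A root is always heavy in its own piece, so its visit overwrites the value that [CEN]
           kept from the previous round. *)
        rewrite rj in rK *; move: h; rewrite top_fix // -addnn.
        have : 0 < #|below p K j| by rewrite card_gt0; apply/set0Pn; exists j; apply: below_refl.
        clear; lia.
    case: (tm1) => [o1 p1 e1].
    case: (boolP (j \in K)) => jK /= u uE; refine (setr u _); rewrite uE ?(top_fix _ jK) //.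
    have jm := notin_neq_max mK jK.
    rewrite -[v]/(val j) p1 // (top1 (p j) _).1 ?top_p //.
    by have := p_gt jm; move: jE; clear; lia.
  split=> // [j|r _]; rewrite addn0 leqNgt ?ltn_ord //.
by move=> s' _ [[_ _ _ h1 h2] so].
Qed.

Definition centroids K (cen : T -> T) : Prop := forall r, r \in K ->
  [/\ top p K (cen r) = r, size0 p K r < (size0 p K (cen r)).*2 &
      forall b, b \notin K -> p b = cen r -> (size0 p K b).*2 <= size0 p K r].

Lemma centroid_memP K s : ord_max \in K -> centroid_mem K n s ->
  exists2 cen, centroids K cen & forall r, r \in K -> arr s CEN r = cen r.
Proof.
move=> mK cm; exists (fun r => inord (arr s CEN r)).
  move=> r rK; have [c [-> _ tc hc mc]] := cm r rK (leq_addl _ _).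
  rewrite inord_val; split=> // b bK pb.
  rewrite leqNgt; apply/negP => hb; have := p_gt (notin_neq_max mK bK).
  rewrite pb; suff : c <= b by clear; lia.
  by apply: mc (leq_addl _ _) _ hb; rewrite -top_p // pb.
by move=> r rK; have [c [-> _ _ _ _]] := cm r rK (leq_addl _ _); rewrite inord_val.
Qed.

Definition hot K (cen : T -> T) : {set T} :=
  [set j | (j \notin K) && ((j == cen (top p K j)) || (p j == cen (top p K j)))].

Lemma hotP K (cen : T -> T) j r : top p K j = r -> (j \in hot K cen) = (j \in at_centroid p K r (cen r)).
Proof. by move=> tj; rewrite !inE tj eqxx. Qed.

Fixpoint chain (nx : nat -> nat) (h : nat) (l : seq T) : Prop :=
  if l is j :: l' then h = j.+1 /\ chain nx (nx j) l' else h = 0.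

Lemma chain_frame (nx nx' : nat -> nat) h (l : seq T) :
  (forall j, j \in l -> nx' j = nx j) -> chain nx h l -> chain nx' h l.
Proof.
elim: l h => [|i l IH] h //= e [-> c]; split=> //.
rewrite e ?mem_head //; apply: IH c => j jl; apply: e.
by rewrite inE jl orbT.
Qed.

Definition bucket_mem K (cen : T -> T) k s : Prop := exists L : nat -> seq T,
  forall x, x < n -> [/\ chain (arr s NEXT) (arr s HEAD x) (L x), uniq (L x) &
    forall j, (j \in L x) = [&& j < k, j \in hot K cen & key p K j == x]].

(** A key is at most half of a piece; hence [n] buckets suffice. *)
Lemma key_lt K j : ord_max \in K -> key p K j < n.
Proof.
move=> mK; have := key_double (erefl (top p K j)).
have : size0 p K (top p K j) <= n by apply: leq_trans (max_card _) _; rewrite card_ord.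
by clear; lia.
Qed.

Lemma bucket_loop_runs K (cen : T -> T) s : bounded X s -> reg s 0 = n -> ord_max \in K ->
  tree_mem s -> cut_mem K s -> size_mem K s -> top_mem K n s ->
  (forall r, r \in K -> arr s CEN r = cen r) -> (forall j, arr s HEAD j = 0) ->
  runs w X bucket_loop s loop_time
    (fun s' => bucket_mem K cen n s' /\ same_off bucket_loop s s').
Proof.
move=> bs r0 mK tm cm sm top0 cen0 head0.
pose I k s := [/\ tree_mem s, cut_mem K s, size_mem K s &
  [/\ (forall j, arr s TOP j = top p K j), (forall r, r \in K -> arr s CEN r = cen r)
    & bucket_mem K cen k s]].
apply: runs_weaken (leqnn _) _.
  apply: (@runs_for_wp w X n 1 _ _ I) => //.
    move=> k s1 kn bs1 r0' rk [tm1 cm1 sm1 [tp1 cn1 [L bk1]]] /=.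
    pose j := Ordinal kn; rewrite rk -[k]/(val j) (cm1 j).
    have skip s2 : tree_mem s2 -> cut_mem K s2 -> size_mem K s2 ->
        (forall j, arr s2 TOP j = top p K j) -> (forall r, r \in K -> arr s2 CEN r = cen r) ->
        arr s2 HEAD = arr s1 HEAD -> arr s2 NEXT = arr s1 NEXT ->
        j \notin hot K cen -> I k.+1 s2.
      move=> h1 h2 h3 h4 h5 h6 h7 hj; split=> //; split=> //; exists L => x xn.
      have [c u m] := bk1 x xn; rewrite h6 h7; split=> // i; rewrite m [in RHS]ltnS [in RHS]leq_eqVlt.
      case: (eqVneq (val i) k) => //= ik; have -> : i = j by apply/val_inj.
      by rewrite (negbTE hj) !andbF.
    case: (boolP (j \in K)) => jK /=; first by apply: skip => //; rewrite inE jK.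
    case: (tm1) => [o1 p1 e1]; have jm := notin_neq_max mK jK.
    move=> r; rewrite (tp1 j) => rE c; rewrite rE cn1 ?top_in // => cE.
    rewrite -[k]/(val j) p1 // cE !val_eqE.
    have -> : ((j == cen (top p K j)) + (p j == cen (top p K j)) != 0)
       = (j \in hot K cen) by rewrite inE jK /=; case: (j == _); case: (p j == _).
    case: ifP => hotj; last by apply: skip => //; rewrite hotj.
    move=> v; rewrite !sm1 => vE u uE.
    have fin s2 W : arr s2 = arr s1 -> W = key p K j ->
        j + 1 <= X /\ I k.+1 (set_arr (set_arr s2 NEXT j (arr s1 HEAD W)) HEAD W (j + 1)).
      move=> aE ->; split; first by rewrite addn1; apply: leq_trans (ltn_ord j) (ltnW ltnX).
      split.
      - by rewrite /tree_mem /= aE.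
      - by rewrite /cut_mem /= aE.
      - by rewrite /size_mem /= aE.
      split; [by rewrite /= aE | by rewrite /= aE |].
      have kj : key p K j < n by apply: key_lt.
      have jL x : x < n -> j \notin L x.
        by move=> xn; have [_ _ ->] := bk1 x xn; rewrite ltnn.
      exists (fun x => if x == key p K j then j :: L x else L x) => x xn.
      have [c1 u1 m1] := bk1 x xn.
      have fr h : chain (arr s1 NEXT) h (L x) ->
        chain (fun i => if i == j then arr s1 HEAD (key p K j) else arr s1 NEXT i) h (L x).
        apply: chain_frame => i iL; case: eqP => // /val_inj ij.
        by move: (jL x xn); rewrite -ij iL.
      rewrite /= aE; case: (eqVneq x (key p K j)) => [xk|xk]; split.
      - by rewrite /= addn1 eqxx; split=> //; apply: fr; rewrite -xk.
      - by rewrite /= jL.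
      - move=> i; rewrite inE m1 [in RHS]ltnS [in RHS]leq_eqVlt; case: (eqVneq i j) => [->|ij] /=.
          by rewrite eqxx hotj xk eqxx.
        by rewrite -val_eqE /= in ij; rewrite (negbTE ij).
      - exact: fr.
      - exact: u1.
      - move=> i; rewrite m1 [in RHS]ltnS [in RHS]leq_eqVlt; case: (eqVneq (val i) k) => //= ik.
        have -> : i = j by apply/val_inj.
        by rewrite ltnn eq_sym (negbTE xk) !andbF.
    have keyE : key p K j = if u < v then u else v.
      by rewrite uE vE /key /size0 minnC /minn.
    move: keyE; case: (ltnP u v) => /= uv kE.
      by move=> z zE; apply: fin => //; rewrite zE kE.
    exact: fin.
  split=> //; split=> // [j|]; first by case: (top0 j (leq_addl _ _)).
  exists (fun=> [::]) => x xn; split=> //=.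
  by have := head0 (Ordinal xn).
by move=> s' _ [[_ _ _ [_ _ h]] so].
Qed.

End Loops.

(** * Cutting the edges at the centroids *)

Section Sweep.

Variables (N : nat) (p : 'I_N.+1 -> 'I_N.+1).
Local Notation T := 'I_N.+1.
Local Notation n := N.+1.
Implicit Types (K : {set T}) (j r c : T) (s : state) (todo : seq T).

Hypothesis p_gt : forall j : T, j != ord_max -> j < p j.

Variables (K0 : {set T}) (cen : T -> T).
Hypotheses (max0 : ord_max \in K0) (cenP : centroids p K0 cen).

(* [todo] lists the candidate edges still to be processed, and [cur] is the size
   of the part containing the centroid of the piece [r], or [0] once that part
   is no longer to be cut. *)
Definition part_inv K todo (cur : nat) r : Prop :=
  let M := main_size p (cen r) K in
  if cur == 0 then is_true (3 * M <= 2 * size0 p K0 r) else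
  [/\ cur = M,
      forall j, j \in hot p K0 cen -> top p K0 j = r -> j \in K \/ j \in todo &
      M = size0 p K0 r \/
      forall j, j \in todo -> top p K0 j = r -> M + key p K0 j <= size0 p K0 r].

Definition cuts_inv K todo : Prop :=
  [/\ K0 \subset K, forall j, j \in K -> j \notin K0 -> j \in hot p K0 cen,
      uniq todo & forall j, j \in todo -> j \in hot p K0 cen /\ j \notin K].

Lemma cuts_at K todo r : cuts_inv K todo -> forall j, j \in K -> j \notin K0 ->
  top p K0 j = r -> j \in at_centroid p K0 r (cen r).
Proof. by move=> [_ hK _ _] j jK jK0 tj; rewrite -hotP // hK. Qed.

Lemma hot_notin j : j \in hot p K0 cen -> j \notin K0.
Proof. by rewrite inE => /andP[]. Qed.

Lemma cuts_inv_next K todo j : cuts_inv K (j :: todo) -> cuts_inv K todo.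
Proof.
move=> [h1 h2 /= /andP[_ h3] h4]; split=> // i it; apply: h4.
by rewrite inE it orbT.
Qed.

Lemma cuts_inv_cut K todo j : cuts_inv K (j :: todo) -> cuts_inv (j |: K) todo.
Proof.
move=> [h1 h2 /= /andP[jt h3] h4]; split=> //.
- by apply: subset_trans h1 (subsetU1 _ _).
- move=> i; rewrite in_setU1 => /orP[/eqP -> _|]; last exact: h2.
  by have [] := h4 j (mem_head _ _).
- move=> i it; have [hi iK] : i \in hot p K0 cen /\ i \notin K.
    by apply: h4; rewrite inE it orbT.
  split=> //; rewrite in_setU1 negb_or iK andbT.
  by apply: contraNneq jt => <-.
Qed.

Lemma part_inv_init r todo : r \in K0 ->
  (forall j, j \in hot p K0 cen -> j \in todo) ->
  part_inv K0 todo (size0 p K0 r) r.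
Proof.
move=> rK0 ht; have [tc _ _] := cenP rK0.
have mE : main_size p (cen r) K0 = size0 p K0 r by rewrite /main_size tc.
rewrite /part_inv mE; case: eqP => [->|_]; first by rewrite muln0.
by split=> //; [move=> j jh _; right; apply: ht | left].
Qed.

Lemma part_inv_other K todo j cur r : top p K0 j != r ->
  part_inv K (j :: todo) cur r -> part_inv K todo cur r.
Proof.
move=> tj; rewrite /part_inv; case: eqP => // _ [h1 h2 h3]; split=> //.
- move=> i ih ti; have [|] := h2 i ih ti; first by left.
  rewrite inE => /orP[/eqP ij|]; last by right.
  by rewrite -ij ti eqxx in tj.
- case: h3 => h3; [by left | right] => i it ti; apply: h3 => //.
  by rewrite inE it orbT.
Qed.

(** The cut happens in another piece of [K0], so the part around the centroid of [r] does not
    change. *)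
Lemma part_inv_other_cut K todo j cur r : cuts_inv K (j :: todo) -> r \in K0 ->
  top p K0 j != r -> part_inv K todo cur r -> part_inv (j |: K) todo cur r.
Proof.
move=> inv rK0 tj; have [K0K _ _ h4] := inv.
have [_ jK] := h4 j (mem_head _ _); have mK := subsetP K0K _ max0.
have [tc _ _] := cenP rK0.
have tjc : top p K (cen r) != top p K j.
  apply: contraNneq tj => e.
  by rewrite -(top_mono p_gt j max0 K0K) -e top_mono // tc.
have mE : main_size p (cen r) (j |: K) = main_size p (cen r) K.
  rewrite /main_size top_cut //; case: ifP => [cj|_].
    by rewrite (top_below p_gt mK cj) eqxx in tjc.
  by rewrite below_cut_other // top_in.
rewrite /part_inv mE; case: eqP => // _ [h1 h2 h3]; split=> // i ih ti.
by have [iK|] := h2 i ih ti; [left; rewrite inE iK orbT | right].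
Qed.

(** Source of the factor 2/3. Write [M] for the part, [k] for the key and [S] for the original
    piece. Before any cut [M = S], and stopping is impossible because [2 k <= S]. Afterwards
    [M + k <= S], and together with [M < 2 k] this gives [3 M < 2 S]. *)
Lemma part_inv_stop K todo j cur : j \in hot p K0 cen ->
  cur < (key p K0 j).*2 -> part_inv K (j :: todo) cur (top p K0 j) ->
  part_inv K todo 0 (top p K0 j).
Proof.
move=> jh lt; rewrite /part_inv eqxx; case: eqP => // _ [cE _ h3].
have := key_double (erefl (top p K0 j)).
case: h3 => [e|/(_ j (mem_head _ _) erefl)]; first by move: lt; rewrite cE e; lia.
by move: lt; rewrite cE; clear; lia.
Qed.

(** * One cut of the sweep *)

Section CutStep.

Variables (K : {set T}) (j : T) (todo : seq T) (cur : nat).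
Let r := top p K0 j.
Hypotheses (inv : cuts_inv K (j :: todo)) (part : part_inv K (j :: todo) cur r)
  (large : (key p K0 j).*2 <= cur)
  (greatest : forall i, i \in todo -> key p K0 i <= key p K0 j).

Let rK0 : r \in K0. Proof. exact: top_in. Qed.
Let K0K : K0 \subset K. Proof. by case: inv. Qed.
Let mK : ord_max \in K. Proof. exact: (subsetP K0K). Qed.
Let jK : j \notin K. Proof. by case: inv => _ _ _ /(_ j (mem_head _ _))[]. Qed.
Let jh : j \in hot p K0 cen. Proof. by case: inv => _ _ _ /(_ j (mem_head _ _))[]. Qed.
Let jc : j \in at_centroid p K0 r (cen r). Proof. by rewrite -hotP. Qed.

Lemma cut_top : top p K j = top p K (cen r).
Proof. exact: (at_centroid_top p_gt max0 K0K jK jc). Qed.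
 
Lemma cut_top_cases : top p K j = if cen r \in K then cen r else r.
Proof.
have [tc _ _] := cenP rK0.
by rewrite cut_top (top_centroid p_gt max0 rK0 tc K0K (cuts_at inv)).
Qed.

Lemma cut_part : 0 < cur /\ cur = main_size p (cen r) K.
Proof.
have kp := key_gt0 p_gt max0 (hot_notin jh).
move: part large; rewrite /part_inv; case: eqP => [-> _|c0 [-> _ _] _].
  by move: kp; clear; lia.
by split=> //; apply: main_size_gt0.
Qed.

Lemma cut_greatest i : i \in at_centroid p K0 r (cen r) -> i \notin K ->
  key p K0 i <= key p K0 j.
Proof.
move=> ic iK; have ti : top p K0 i = r by move: ic; rewrite inE => /and3P[_ /eqP].
have [c0 cE] := cut_part; move: part; rewrite /part_inv -(negbK (cur == 0)).
rewrite -lt0n c0 => -[_ h2 _].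
have ih : i \in hot p K0 cen by rewrite (hotP _ ti).
case: (h2 i ih ti) => [|]; first by rewrite (negbTE iK).
by rewrite inE => /orP[/eqP -> //|/greatest].
Qed.

(** The side just removed is at least as large as any key still to come, which gives the last clause
    of the invariant. *)
Lemma part_inv_cut : part_inv (j |: K) todo (cur - key p K0 j) r.
Proof.
have [tc hc lc] := cenP rK0; have [c0 cE] := cut_part.
have mE : main_size p (cen r) (j |: K) = cur - key p K0 j.
  by rewrite cE -(main_size_cut p_gt max0 rK0 tc hc lc K0K (cuts_at inv) jK jc).
have k0 := key_gt0 p_gt max0 (hot_notin jh).
rewrite /part_inv mE; case: eqP => [e|_].
  by move: e large k0; clear; lia.
move: part; rewrite /part_inv -(negbK (cur == 0)) -lt0n c0 -cE => -[_ h2 h3].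
split=> //.
  move=> i ih ti; case: (h2 i ih ti) => [iK|]; first by left; rewrite inE iK orbT.
  by rewrite inE => /orP[/eqP ->|]; [left; rewrite !inE eqxx | right].
right=> i it ti; have := greatest it; case: h3 => [|/(_ j (mem_head _ _) erefl)].
  by rewrite -/r; move: large; clear; lia.
by rewrite -/r; move: large; clear; lia.
Qed.

Variables (q : T -> T) (G : graph T).
Hypotheses (q_inj : injective q) (edgesG : edges G = link p q @: [set~ ord_max]).

(** By [max_sides] the larger side left by [j] is the part minus its key. A rival leaves at least
    the part minus its own key, and [key_max] with the order of processing bounds that key by the
    one of [j]. *)
Lemma cut_balanced : balanced (piece p q G K (top p K j)) (link p q j).
Proof.
have [tc hc lc] := cenP rK0; have [c0 cE] := cut_part.
have at_c := cuts_at inv.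
apply: balanced_cut => //; first exact: top_in.
move=> f fK; rewrite cut_top => tf.
rewrite -/(main_size p (cen r) K).
rewrite (max_sides p_gt max0 rK0 tc hc lc K0K (at_c r) jK jc) -?cE //.
rewrite cE; apply: leq_trans (max_sides_ge p_gt max0 tc K0K fK tf).
apply: leq_sub2l.
have [b [bK bc fb]] := key_max p_gt max0 rK0 tc hc lc K0K (at_c r) fK tf.
exact: leq_trans fb (cut_greatest bc bK).
Qed.

End CutStep.

(** A part around a centroid either was stopped, with its bound recorded then, or has lost all edges
    at the centroid and is a single vertex. The other parts have at most half of their piece. *)
Lemma sweep_shrinks K cur : cuts_inv K [::] ->
  (forall r, r \in K0 -> part_inv K [::] (cur r) r) ->
  forall x, #|below p K (top p K x)| <= 1 \/
    3 * #|below p K (top p K x)| <= 2 * size0 p K0 (top p K0 x).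
Proof.
move=> inv part x; have K0K : K0 \subset K by case: inv.
set r := top p K0 x; have rK0 : r \in K0 by apply: top_in.
have [tc hc lc] := cenP rK0; have at_c := @cuts_at _ _ r inv.
have [tx|tx] := eqVneq (top p K x) (top p K (cen r)).
  rewrite tx -/(main_size p (cen r) K); have := part r rK0; rewrite /part_inv.
  case: eqP => _; first by right.
  move=> [_ h2 _]; left.
  apply: (main_size_done p_gt max0 rK0 tc hc lc K0K at_c); apply/subsetP => i ic.
  have ti : top p K0 i = r by move: ic; rewrite inE => /and3P[_ /eqP].
  by have [] := h2 i _ ti; rewrite ?(hotP _ ti).
right; have := side_small p_gt max0 rK0 tc hc lc K0K at_c (erefl r) tx.
by clear; lia.
Qed.

End Sweep.

(** [TOP] still describes the start of the round. The present root of the part is the centroid if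
    its upward edge has been cut, and the old root otherwise. Register 10 counts the uncut edges. *)
Definition cut_edge : prog :=
  Put CUR (Reg 4) (Bin Defs.Sub (Get CUR (Reg 4)) (Reg 2)) ;;
  SetReg 5 (Get CEN (Reg 4)) ;;
  If (Get CUT (Reg 5)) (SetReg 4 (Reg 5)) Skip ;;
  Put CUT (Reg 3) (Lit 1) ;;
  SetReg 10 (Bin Defs.Sub (Reg 10) (Lit 1)) ;;
  SetReg 6 (Get EID (Reg 3)) ;;
  If (Get SIDE (Reg 4)) (Put 3 (Get SLOT (Reg 4)) (Bin Add (Reg 0) (Reg 6)))
                        (Put 2 (Get SLOT (Reg 4)) (Bin Add (Reg 0) (Reg 6))) ;;
  Put SLOT (Reg 3) (Reg 6) ;;
  Put SIDE (Reg 3) (Lit 0) ;;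
  Put SLOT (Reg 4) (Reg 6) ;;
  Put SIDE (Reg 4) (Lit 1).

(** An iteration pops a candidate or moves to the next lower bucket, hence at most [2 n] iterations.
    Storing [0] in [CUR] closes a piece: keys are positive, so the same comparison discards all its
    later candidates. *)
Definition sweep_body : prog :=
  SetReg 2 (Bin Defs.Sub (Reg 12) (Lit 1)) ;;
  SetReg 3 (Get HEAD (Reg 2)) ;;
  If (Reg 3) (
    SetReg 3 (Bin Defs.Sub (Reg 3) (Lit 1)) ;;
    Put HEAD (Reg 2) (Get NEXT (Reg 3)) ;;
    SetReg 4 (Get TOP (Reg 3)) ;;
    If (Bin Less (Get CUR (Reg 4)) (Bin Add (Reg 2) (Reg 2)))
      (Put CUR (Reg 4) (Lit 0)) cut_edge)
   (SetReg 12 (Reg 2)).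

Definition sweep_loop : prog := SetReg 12 (Reg 0) ;; While (Reg 12) sweep_body.

(** * Correctness and running time of the sweep *)

Section SweepRun.

Variables (w X N : nat) (p q : 'I_N.+1 -> 'I_N.+1) (G : graph 'I_N.+1).
Variables (es : seq ('I_N.+1 * 'I_N.+1)) (eid : 'I_N.+1 -> nat).
Local Notation T := 'I_N.+1.
Local Notation n := N.+1.
Implicit Types (K : {set T}) (j r c : T) (s : state) (todo l : seq T) (nx hd : nat -> nat).

Hypothesis wX : 64 * X < 2 ^ w.
Hypothesis nX : n.+2 * n.+2 <= X.
Hypothesis p_gt : forall j : T, j != ord_max -> j < p j.
Hypothesis q_inj : injective q.
Hypothesis edgesG : edges G = link p q @: [set~ ord_max].
Hypothesis eid_lt : forall j : T, j != ord_max -> eid j < n.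
Hypothesis eid_inj : forall i j : T, i != ord_max -> j != ord_max -> eid i = eid j -> i = j.
Hypothesis eid_link : forall j : T, j != ord_max ->
  onth [seq edge_of e | e <- es] (eid j) = Some (link p q j).

Variables (K0 : {set T}) (cen : T -> T).
Hypotheses (max0 : ord_max \in K0) (cenP : centroids p K0 cen).

Local Notation key := (key p K0).
Local Notation hot := (hot p K0 cen).

(** The order of processing: the buckets [x - 1] down to [0], concatenated. *)
Fixpoint sched nx hd (x : nat) l : Prop :=
  if x is y.+1 then exists l1 l2, [/\ l = l1 ++ l2, chain nx (hd y) l1,
      forall j, j \in l1 -> key j = y & sched nx hd y l2]
  else l = [::].

Lemma sched_key nx hd x l j : sched nx hd x l -> j \in l -> key j < x.
Proof.
elim: x l => [|x IH] l /=; first by move=> ->.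
move=> [l1 [l2 [-> _ k1 s2]]]; rewrite mem_cat => /orP[/k1 -> //|jl].
exact/ltnW/(IH _ s2 jl).
Qed.

Lemma sched_frame nx hd hd' x l :
  (forall y, y < x -> hd' y = hd y) -> sched nx hd x l -> sched nx hd' x l.
Proof.
elim: x l => [|x IH] l //= e [l1 [l2 [-> c1 k1 s2]]]; exists l1, l2.
by split=> //; [rewrite e | apply: IH s2 => y yx; apply/e/ltnW].
Qed.

Lemma bucket_sched s : bucket_mem p K0 cen n s -> exists todo,
  [/\ sched (arr s NEXT) (arr s HEAD) n todo, uniq todo &
      forall j, (j \in todo) = (j \in hot)].
Proof.
move=> [L bk]; have sch x : x <= n -> exists todo,
    [/\ sched (arr s NEXT) (arr s HEAD) x todo, uniq todo &
        forall j, (j \in todo) = (j \in hot) && (key j < x)].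
  elim: x => [|x IH] xn; first by exists [::]; split=> // j; rewrite ltn0 andbF.
  have [todo [h1 h2 h3]] := IH (ltnW xn); have [c1 u1 m1] := bk x xn.
  exists (L x ++ todo); split.
  - by exists (L x), todo; split=> // j; rewrite m1 => /and3P[_ _ /eqP].
  - rewrite cat_uniq u1 h2 andbT; apply/hasPn => j; rewrite h3 m1 => /andP[_ kx].
    by rewrite ltn_ord /= negb_and neq_ltn kx /= orbT.
  - move=> j; rewrite mem_cat h3 m1 ltn_ord /= -andb_orr; congr (_ && _).
    by rewrite [in RHS]ltnS [RHS]leq_eqVlt.
have [todo [h1 h2 h3]] := sch n (leqnn n); exists todo; split=> // j.
by rewrite h3 key_lt // andbT.
Qed.

Definition sweep_mem K todo s : Prop :=
  [/\ tree_mem p q eid s, cut_mem K s, reg s 10 = #|~: K|, reg s 0 = n &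
    [/\ forall j, arr s TOP j = top p K0 j, forall r, r \in K0 -> arr s CEN r = cen r,
        forall r, r \in K0 -> part_inv p K0 cen K todo (arr s CUR r) r &
        assembly p q G es eid K s]].

Lemma cut_edge_wp K j todo s :
  cuts_inv p K0 cen K (j :: todo) -> sweep_mem K (j :: todo) s ->
  (key j).*2 <= arr s CUR (top p K0 j) ->
  (forall i, i \in todo -> key i <= key j) ->
  reg s 2 = key j -> reg s 3 = j -> reg s 4 = top p K0 j ->
  wp X cut_edge (fun s' => [/\ sweep_mem (j |: K) todo s', arr s' HEAD = arr s HEAD,
    arr s' NEXT = arr s NEXT & reg s' 12 = reg s 12]) s.
Proof.
move=> inv [tm cm cnt r0 [tp cn part asm]] large great r2 r3 r4.
set r := top p K0 j in large r4.
have rK0 : r \in K0 by apply: top_in.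
have part_r := part r rK0.
have K0K : K0 \subset K by case: inv.
have mK := subsetP K0K _ max0.
have [jh jK] : j \in hot /\ j \notin K by case: inv => _ _ _ /(_ j (mem_head _ _)).
have jm := notin_neq_max mK jK.
have bal := cut_balanced p_gt max0 cenP inv part_r large great q_inj edgesG.
have topj := cut_top_cases p_gt max0 cenP inv.
set R := top p K j in bal topj.
rewrite /cut_edge /= r2 r3 r4 => v; rewrite cn // => ->.
rewrite -/r in topj *.
(* [fin] asks only for the new contents of the arrays; [wr] checks them on the literal memory, with
   [z] the root found by the conditional. *)
have fin (z : T) s2 : z = R -> (forall a, a \in [:: ORD; EID; PAR; TOP; CEN; HEAD; NEXT] -> arr s2 a = arr s a) ->
    (forall i : T, arr s2 CUR i = if i == r then arr s CUR r - key j else arr s CUR i) ->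
    (forall i : T, arr s2 CUT i = if i == j then 1 else arr s CUT i) ->
    reg s2 10 = (reg s 10).-1 -> reg s2 0 = n -> reg s2 12 = reg s 12 ->
    (forall b i, b \in [:: 2; 3] -> arr s2 b i =
     if (b, i) == cell s z then n + eid j else arr s b i) ->
    (forall i : T, arr s2 SLOT i =
      if (i == j) || (i == z) then eid j else arr s SLOT i) ->
    (forall i : T, arr s2 SIDE i =
     if i == z then 1 else if i == j then 0 else arr s SIDE i) ->
    [/\ sweep_mem (j |: K) todo s2, arr s2 HEAD = arr s HEAD,
    arr s2 NEXT = arr s NEXT & reg s2 12 = reg s 12].
  move=> zR; rewrite {z}zR => same cur2 cut2 cnt2 r02 r12 out2 slot2 side2; split=> //; last 2 first.
  - exact: same.
  - exact: same.
  split=> //.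
  - by case: tm => t1 t2 t3; split=> [i|i|i]; rewrite same //; [apply: t2 | apply: t3].
  - by move=> i; rewrite cut2 in_setU1; case: eqP => //= _; apply: cm.
  - rewrite cnt2 cnt (cardsD1 j (~: K)) inE jK /=; congr #|pred_of_set _|.
    by apply/setP=> i; rewrite !inE negb_or.
  - split.
    + by move=> i; rewrite same.
    + by move=> r' r'K; rewrite same // cn.
    + move=> r' r'K; rewrite cur2; case: eqP => [->|/eqP nr].
        exact: (part_inv_cut p_gt max0 cenP inv part_r large great).
      have nr' : top p K0 j != r' by rewrite eq_sym.
      apply: (part_inv_other_cut p_gt max0 cenP inv r'K nr').
      exact: (part_inv_other nr' (part r' r'K)).
    + exact: (assembly_cut p_gt q_inj edgesG eid_lt eid_inj eid_link mK jK bal out2 slot2 side2 asm).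
have jR : (R == j) = false.
  by apply/negP => /eqP Rj; move: jK; rewrite -Rj /R top_in.
have eX : n + eid j <= X by have := eid_lt jm; move: nX; clear; nia.
have wr (z : T) (s2 := set_arr
     (set_reg (set_reg (set_arr (set_reg (set_reg (set_arr s CUR r (arr s CUR r - key j)) 5 (cen r)) 4 z) CUT j 1)
       10 (reg s 10 - 1)) 6 (eid j))
     (if arr s SIDE z == 0 then 2 else 3) (arr s SLOT z) (n + eid j)) : z = R ->
   let s' := set_arr (set_arr (set_arr (set_arr s2 SLOT j (eid j)) SIDE j 0) SLOT z (eid j)) SIDE z 1 in
   [/\ sweep_mem (j |: K) todo s', arr s' HEAD = arr s HEAD,
    arr s' NEXT = arr s NEXT & reg s' 12 = reg s 12].
  move=> zR; apply: (fin z) => //=.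
  - move=> a; rewrite !inE; case: (_ == 0); by repeat case/orP => [/eqP -> //|]; move=> /eqP ->.
  - by move=> i; rewrite -val_eqE; case: (_ == 0).
  - by move=> i; rewrite -val_eqE; case: (_ == 0).
  - by rewrite subn1.
  - move=> b i; rewrite !inE /cell /= xpair_eqE; case: (_ == 0);
    by case/orP => /eqP ->.
  - move=> i; rewrite -!val_eqE /=; case: (_ == 0) => /=; rewrite orbC; by case: (_ == _).
  - by move=> i; rewrite -!val_eqE /=; case: (arr s 19 z == 0).
rewrite cm r0; case: (boolP (cen r \in K)) topj => cK topj /=.
  move=> v4 -> v5 -> v6; case: (tm) => _ _ -> // ->.
  have := wr _ (esym topj); case: (arr s SIDE (cen r)) => [|m] /=; by split.
move=> v5 -> v6; case: (tm) => _ _ -> // ->.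
have := wr _ (esym topj); case: (arr s SIDE r) => [|m] /= h; split=> //; exact: h.
Qed.

Definition sweep_state (m : nat) s : Prop := exists K todo,
  [/\ cuts_inv p K0 cen K todo, sweep_mem K todo s,
      sched (arr s NEXT) (arr s HEAD) (reg s 12) todo,
      m = reg s 12 + size todo & reg s 12 <= n].

Lemma sweep_body_wp m s : sweep_state m s -> reg s 12 != 0 ->
  wp X sweep_body (fun s' => exists2 m', m' < m & sweep_state m' s') s.
Proof.
move=> [K [todo [inv mem sch mE xn]]] x0.
case xE : (reg s 12) x0 => [//|x] _; rewrite xE in sch mE xn.
have {sch} [l1 [l2 [todoE c1 k1 s2]]] := sch.
rewrite /sweep_body; move ceE: cut_edge => ce; rewrite /= xE subn1 /= => v vE h.
rewrite vE => hE.
case: l1 todoE c1 k1 => [|j l1] /= todoE c1 k1.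
  rewrite hE c1 /= => v2 ->; exists m.-1; first by rewrite mE; clear; lia.
  exists K, todo; split=> //; first by rewrite todoE.
    by rewrite mE.
  exact: ltnW.
have [hj {}c1] := c1; rewrite hE hj /= subn1 /= => v3 v3E.
rewrite v3E => u uE.
have [tm cm cnt r0 [tp cn part asm]] := mem.
have kj : key j = x by apply: k1; rewrite mem_head.
rewrite todoE in inv mE mem part.
have keys i : i \in l1 ++ l2 -> key i <= key j.
  rewrite mem_cat => /orP[il|il]; first by rewrite k1 ?inE ?il ?orbT ?kj.
  by rewrite kj; apply/ltnW/(sched_key s2 il).
rewrite tp in uE; rewrite uE => {u uE}.
set s0 := set_reg (set_reg (set_reg s 2 x) 3 j.+1) 3 j.
set s1 := set_reg (set_arr s0 15 x (arr s 16 j)) 4 (top p K0 j).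
have sch1 : sched (arr s1 NEXT) (arr s1 HEAD) x.+1 (l1 ++ l2).
  exists l1, l2; split=> //.
  - by rewrite /= eqxx.
  - by move=> i il; apply: k1; rewrite inE il orbT.
  - by apply: sched_frame s2 => y yx /=; rewrite ltn_eqF.
have asm1 : assembly p q G es eid K s1.
  exact: (@assembly_set_arr _ p q G es eid K s0 HEAD x (arr s 16 j) isT asm).
have mem1 : sweep_mem K (j :: l1 ++ l2) s1.
  exact: (And5 tm cm cnt r0 (And4 tp cn part asm1)).
have jh : j \in hot by case: inv => _ _ _ /(_ j (mem_head _ _))[].
have rK0 : top p K0 j \in K0 by apply: top_in.
have part_j := part _ rK0.
have mlt : x.+1 + size (l1 ++ l2) < m by rewrite mE /= addnS.
case: (ltnP (arr s CUR (top p K0 j)) (x + x)) => /= small.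
  exists (x.+1 + size (l1 ++ l2)) => //; exists K, (l1 ++ l2); split=> //; last 2 first.
  - by rewrite /= xE.
  - by rewrite /= xE.
  - exact: cuts_inv_next inv.
  - split=> //; split=> //; last exact: assembly_set_arr asm1.
    move=> r rK; rewrite /= val_eqE; case: eqP => [->|/eqP nr].
      by apply: (part_inv_stop max0 jh _ part_j); rewrite kj -addnn.
    by apply: (@part_inv_other _ _ _ _ _ _ j); [rewrite eq_sym | apply: part].
  - by rewrite /= xE; exact: sch1.
have large : (key j).*2 <= arr s1 CUR (top p K0 j) by rewrite kj -addnn.
rewrite -ceE; apply: (wp_mono _ (cut_edge_wp inv mem1 large keys (esym kj) erefl erefl)).
move=> s' [mem' hE' nE' xE']; exists (x.+1 + size (l1 ++ l2)) => //.
exists (j |: K), (l1 ++ l2); rewrite xE' /= xE; split=> //.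
  exact: cuts_inv_cut inv.
by rewrite hE' nE'.
Qed.

(** At most [2 n] iterations of at most 102 steps each, with room to spare. *)
Definition sweep_time := 300 * n + 10.

Lemma sweep_loop_runs s : bounded X s -> reg s 0 = n ->
  tree_mem p q eid s -> cut_mem K0 s -> reg s 10 = #|~: K0| ->
  (forall j, arr s TOP j = top p K0 j) -> (forall r, r \in K0 -> arr s CEN r = cen r) ->
  (forall r, r \in K0 -> arr s CUR r = size0 p K0 r) ->
  bucket_mem p K0 cen n s -> assembly p q G es eid K0 s ->
  runs w X sweep_loop s sweep_time (fun s' => exists K,
    [/\ tree_mem p q eid s', cut_mem K s', reg s' 10 = #|~: K|, reg s' 0 = n &
      [/\ K0 \subset K, assembly p q G es eid K s' &
        forall x, #|below p K (top p K x)| <= 1 \/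
          3 * #|below p K (top p K x)| <= 2 * size0 p K0 (top p K0 x)]]).
Proof.
move=> bs r0 tm cm cnt tp cn cur /bucket_sched[todo [sch ut todoE]] asm.
have X0 : 0 < X by move: nX; clear; lia.
apply: (@runs_weaken _ _ _ _ (2 + ((n + size todo) * (100 + 2) + 2))).
- apply: (@runs_seq _ _ _ _ _ _ _ (sweep_state (n + size todo))).
    apply: (@runs_wp _ _ X0 (SetReg 12 (Reg 0))) => //=.
      by move: wX; clear; lia.
    move=> v ->; exists K0, todo; rewrite /= r0; split=> //.
      split=> // [j ->//|j]; rewrite todoE => jh; split=> //; exact: hot_notin jh.
    split=> //; split=> // r rK; rewrite /= cur //; apply: part_inv_init => // j.
    by rewrite todoE.
  move=> s1 bs1 st1.
  apply: (@runs_while w X X0 (Reg 12) sweep_body sweep_state 100 _ s1) => //=.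
    by move: wX; clear; lia.
  move=> m s2 bs2 st2 x0.
  apply: (runs_weaken (runs_wp X0 _ bs2 (sweep_body_wp st2 x0))) => //.
  by apply: leq_ltn_trans wX; rewrite leq_mul2r; apply/orP; right.
- have : size todo <= n.
    by rewrite -(card_uniqP ut) -[leqRHS]card_ord; apply: max_card.
  by rewrite /sweep_time; clear; lia.
- move=> s' bs' [x0 [m [K [td [inv [tm' cm' cnt' r0' [tp' cn' part asm']] sch' _ _]]]]].
  rewrite /= in x0; rewrite x0 /= in sch'; exists K; split=> //.
  split=> //; first by case: inv.
  by subst td; apply: (sweep_shrinks p_gt max0 cenP inv part).
Qed.

End SweepRun.

(** * Rounds *)

Definition round : prog :=
  reset_loop ;; size_loop ;; top_loop ;; bucket_loop ;; sweep_loop.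

Definition cutting_loop : prog := While (Reg 10) round.

Definition leaf_loop : prog :=
  For 1 (If (Get SIDE (Reg 1)) (Put 3 (Get SLOT (Reg 1)) (Get ORD (Reg 1)))
                               (Put 2 (Get SLOT (Reg 1)) (Get ORD (Reg 1)))).

Definition cutting : prog :=
  cutting_loop ;; leaf_loop ;; SetReg 0 (Get 2 (Reg 0)).

(** Two rounds shrink by 4/9, more than a halving: for [t = 2 (L + 1) + d] the proof compares
    [8 ^ (L + 1) 2 ^ d] with [9 ^ (L + 1) 3 ^ d]. The 2 on the left stands for a piece that still
    has an edge, hence two vertices. *)
Lemma rounds_bound n t : 0 < n -> 2 * 3 ^ t <= 2 ^ t * n -> t <= 2 * trunc_log 2 n + 1.
Proof.
move=> n0 h; rewrite leqNgt; apply/negP => lt; set L := trunc_log 2 n in lt.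
have nL : n < 2 ^ L.+1 by apply: trunc_log_ltn.
have [d tE] : exists d, t = 2 * L.+1 + d by exists (t - 2 * L.+1); move: lt; clear; lia.
have : 2 ^ t * 2 ^ L.+1 <= 3 ^ t.
  rewrite tE !expnD !(expnM _ 2) -mulnA [_ ^ d * _]mulnC mulnA -expnMn.
  by apply: leq_mul; [apply: leq_exp2r | case: d {tE} => // d; rewrite leq_exp2r].
have : 2 ^ t * n < 2 ^ t * 2 ^ L.+1 by rewrite ltn_pmul2l // expn_gt0.
by move: h; clear; lia.
Qed.

Lemma arr_set_arr s a i v b k :
  arr (set_arr s a i v) b k = if (b, k) == (a, i) then v else arr s b k.
Proof. by rewrite xpair_eqE. Qed.

Section Rounds.

Variables (w X N : nat) (p q : 'I_N.+1 -> 'I_N.+1) (G : graph 'I_N.+1).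
Variables (es : seq ('I_N.+1 * 'I_N.+1)) (eid : 'I_N.+1 -> nat).
Local Notation T := 'I_N.+1.
Local Notation n := N.+1.
Implicit Types (K : {set T}) (j r c x : T) (s : state).

Hypothesis wX : 64 * X < 2 ^ w.
Hypothesis nX : n.+2 * n.+2 <= X.
Hypothesis p_gt : forall j : T, j != ord_max -> j < p j.
Hypothesis q_inj : injective q.
Hypothesis vertsG : verts G = [set: T].
Hypothesis edgesG : edges G = link p q @: [set~ ord_max].
Hypothesis eid_lt : forall j : T, j != ord_max -> eid j < n.
Hypothesis eid_inj : forall i j : T, i != ord_max -> j != ord_max -> eid i = eid j -> i = j.
Hypothesis eid_link : forall j : T, j != ord_max ->
  onth [seq edge_of e | e <- es] (eid j) = Some (link p q j).

Let X0 : 0 < X. Proof. by move: nX; clear; lia. Qed.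

Definition cut_state K s : Prop :=
  [/\ tree_mem p q eid s, cut_mem K s, reg s 10 = #|~: K|, reg s 0 = n &
      ord_max \in K /\ assembly p q G es eid K s].

(** The first four loops of a round write scratch memory only; the two side conditions are decided
    by computation. *)
Lemma cut_state_same_off P K s s' : same_off P s s' ->
  all (fun a => a \notin written_arrs P) [:: 2; 3; ORD; EID; PAR; CUT; SLOT; SIDE] ->
  all (fun z => z \notin written_regs P) [:: 0; 10] ->
  cut_state K s -> cut_state K s'.
Proof.
move=> [sr sa] ha hr [[t1 t2 t3] cm cnt r0 [mK asm]].
have same a : a \in [:: 2; 3; ORD; EID; PAR; CUT; SLOT; SIDE] -> arr s' a =1 arr s a.
  by move=> /(allP ha) na i; apply: sa.
have samer z : z \in [:: 0; 10] -> reg s' z = reg s z by move=> /(allP hr) /sr.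
split; try by rewrite samer.
- by split=> j; rewrite same //; [apply: t2 | apply: t3].
- by move=> j; rewrite same //; apply: cm.
- split=> //; apply: assembly_ext asm => a ha'; apply: same.
  by move: ha'; rewrite !inE; do 3?case/orP=> [/eqP -> //|]; move/eqP ->.
Qed.

Definition round_time := 4 * loop_time N + sweep_time N.

Lemma round_runs K s : bounded X s -> cut_state K s ->
  runs w X round s round_time (fun s' => exists K', cut_state K' s' /\
    forall x, #|below p K' (top p K' x)| <= 1 \/
      3 * #|below p K' (top p K' x)| <= 2 * #|below p K (top p K x)|).
Proof.
move=> bs cs; have [_ _ _ r0 [mK _]] := cs.
have -> : round_time = loop_time N + (loop_time N + (loop_time N + (loop_time N + sweep_time N))).
  by rewrite /round_time; clear; lia.
apply: runs_seq (reset_loop_runs wX nX bs r0) _ => s1 bs1 [sz1 so1].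
have {cs}cs1 := cut_state_same_off so1 isT isT cs.
have [tm1 cm1 _ r01 _] := cs1.
apply: runs_seq (size_loop_runs p_gt wX nX bs1 r01 mK tm1 cm1 (fun j => (sz1 j).1)) _ => s2 bs2 [sm2 so2].
have hd2 j : arr s2 HEAD j = 0 by rewrite so2.2 //; apply: (sz1 j).2.
have {cs1}cs2 := cut_state_same_off so2 isT isT cs1.
have [tm2 cm2 _ r02 _] := cs2.
apply: runs_seq (top_loop_runs p_gt wX nX bs2 r02 mK tm2 cm2 sm2) _ => s3 bs3 [tp3 [cn3 so3]].
have hd3 j : arr s3 HEAD j = 0 by rewrite so3.2 // hd2.
have sm3 : size_mem p K s3 by move=> j; rewrite so3.2 // sm2.
have {cs2}cs3 := cut_state_same_off so3 isT isT cs2.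
have [tm3 cm3 _ r03 _] := cs3.
have [cen cenP cenE] := centroid_memP p_gt mK cn3.
apply: runs_seq (bucket_loop_runs p_gt wX nX bs3 r03 mK tm3 cm3 sm3 tp3 cenE hd3) _ => s4 bs4 [bk4 so4].
have {cs3}cs4 := cut_state_same_off so4 isT isT cs3.
have [tm4 cm4 cnt4 r04 [_ asm4]] := cs4.
have := sweep_loop_runs wX nX p_gt q_inj edgesG eid_lt eid_inj eid_link mK cenP bs4 r04 tm4 cm4 cnt4.
have topE j : arr s4 TOP j = top p K j by rewrite so4.2 //; case: (tp3 j (leq_addl _ _)).
have curE j : arr s4 CUR j = #|below p K j| by rewrite so4.2 //; case: (tp3 j (leq_addl _ _)).
have cenE4 r : r \in K -> arr s4 CEN r = cen r by move=> rK; rewrite so4.2 // cenE.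
move=> /(_ topE cenE4 (fun r _ => curE r) bk4 asm4) run5.
apply: runs_weaken run5 (leqnn _) _ => s5 _ [K' [tm5 cm5 cnt5 r05 [KK' asm5 shr]]].
by exists K'; split=> //; split=> //; split=> //; apply: (subsetP KK').
Qed.

Definition cutting_loop_time :=
  (2 * trunc_log 2 n + 2) * (round_time + 2) + 2.

Lemma cutting_loop_runs s : bounded X s -> cut_state [set ord_max] s ->
  runs w X cutting_loop s cutting_loop_time (cut_state [set: T]).
Proof.
move=> bs cs; set R := 2 * trunc_log 2 n + 2.
(* [t] is the number of completed rounds. Single vertices are exempt from the bound since they
   cannot shrink further. *)
pose I m s := exists K t, [/\ cut_state K s, m = R - t &
  forall x, #|below p K (top p K x)| <= 1 \/
    3 ^ t * #|below p K (top p K x)| <= 2 ^ t * n].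
have I0 : I R s.
  exists [set ord_max], 0; rewrite subn0; split=> // x; right.
  by rewrite !mul1n; apply: leq_trans (max_card _) _; rewrite card_ord.
apply: (runs_weaken (@runs_while w X X0 (Reg 10) round I round_time R s _ _ bs I0)) => //=.
- by move: wX; clear; lia.
- move=> m s1 bs1 [K [t [cs1 mE szs]]] nz.
  have [_ _ cnt _ [mK _]] := cs1.
  apply: runs_weaken (round_runs bs1 cs1) (leqnn _) _ => s2 _ [K' [cs2 shr]].
  (* An uncut edge forces a piece with two vertices, which limits [t]; so the truncated difference
     [R - t] really decreases. *)
  have tR : t < R.
    have : 0 < #|~: K| by rewrite -cnt lt0n.
    rewrite card_gt0 => /set0Pn[x]; rewrite inE => xK.
    have big : 1 < #|below p K (top p K x)|.
      rewrite (cardsD1 (top p K x)) below_refl add1n ltnS card_gt0.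
      apply/set0Pn; exists x; rewrite in_setD1 below_top andbT.
      by apply: contraNneq xK => ->; apply: top_in.
    rewrite /R addnS ltnS; apply: rounds_bound => //.
    case: (szs x) => [|h]; first by move: big; clear; lia.
    by apply: leq_trans h; rewrite mulnC leq_mul2l big orbT.
  exists (R - t.+1); first by move: mE tR; clear; lia.
  exists K', t.+1; split=> // x; case: (shr x) => h; first by left.
  case: (szs x) => h'; first by left; move: h h'; clear; lia.
  right; rewrite !expnS; move: h h'.
  set a := #|_|; set b := #|_|; move: (3 ^ t) (2 ^ t) => u v h1 h2.
  by have := leq_mul (leqnn u) h1; move: h2; clear; lia.
- move=> s' _ [r10 [m [K [t [cs' _ _]]]]].
  suff -> : [set: T] = K by [].
  have [_ _ cnt _ _] := cs'; move: cnt; rewrite r10 => /esym/eqP.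
  by rewrite cards_eq0 => /eqP KC; rewrite -(setCK K) KC setC0.
Qed.

(** The waiting cells are distinct, so filling one never spoils another, and their addresses in
    [SLOT] and [SIDE] are not written. *)
Lemma leaf_loop_runs s : bounded X s -> cut_state [set: T] s ->
  runs w X leaf_loop s (loop_time N) (fun s' => reg s' 0 = n /\
    exists B, balanced_ept G B /\ outputs es s' (arr s' 2 n) B).
Proof.
move=> bs [[ord _ _] _ _ r0 [_ asm]].
have [_ inj _] := asm.
have cinj r r' : cell s r = cell s r' -> r = r' by apply: inj; rewrite inE.
pose I k s' := [/\ forall j, arr s' ORD j = q j, forall j, cell s' j = cell s j,
  forall b i, b \in [:: 2; 3] -> (forall r, cell s r <> (b, i)) -> arr s' b i = arr s b i &
  forall r, r < k -> arr s' (cell s r).1 (cell s r).2 = q r].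
apply: runs_weaken (leqnn _) _.
  apply: (@runs_for_wp w X n 1 _ _ I) => //; first by move: nX; clear; nia.
  move=> k s1 kn bs1 _ rk [o1 c1 f1 d1] /=; pose j := Ordinal kn.
  have cellE s' i : cell s' i = (if arr s' SIDE i == 0 then 2 else 3, arr s' SLOT i) by [].
  have st : I k.+1 (set_arr s1 (cell s j).1 (cell s j).2 (q j)).
    have c2 : (cell s j).1 \in [:: 2; 3] by rewrite /cell /=; case: ifP.
    have off a i : a \notin [:: 2; 3] ->
        arr (set_arr s1 (cell s j).1 (cell s j).2 (q j)) a i = arr s1 a i.
      by move=> na /=; case: eqP => //= e; rewrite e c2 in na.
    split.
    - by move=> i; rewrite off.
    - by move=> i; rewrite -[RHS]c1 [LHS]cellE [RHS]cellE !off.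
    - move=> b i hb hc; rewrite arr_set_arr -surjective_pairing.
      by case: eqP => [e|_]; [case: (hc j) | apply: f1].
    - move=> r; rewrite ltnS leq_eqVlt arr_set_arr -!surjective_pairing.
      case: (eqVneq (cell s r) (cell s j)) => [/cinj -> //|ne].
      case/orP => [/eqP rk'|]; last exact: d1.
      by rewrite (_ : r = j) ?eqxx // in ne; apply: val_inj.
  rewrite rk -[k]/(val j) o1.
  move: st; rewrite -(c1 j) /cell /=; case: (arr s1 SIDE k) => //.
move=> s' _ [[_ _ f d] so]; split; first by rewrite so.1.
exact: assembly_done asm f (fun r => d r (ltn_ord r)).
Qed.

Lemma outputs_set_reg s z v k t : outputs es s k t -> outputs es (set_reg s z v) k t.
Proof.
elim: t k => [//|e t1 IH1 t2 IH2] k /= [i [kE eE o1 o2]]; exists i.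
by split=> //; [apply: IH1 | apply: IH2].
Qed.

Definition cutting_time := cutting_loop_time + (loop_time N + 3).

Lemma cutting_runs s : bounded X s -> cut_state [set ord_max] s ->
  runs w X cutting s cutting_time (fun s' => exists B,
    balanced_ept G B /\ outputs es s' (reg s' 0) B).
Proof.
move=> bs cs; apply: runs_seq (cutting_loop_runs bs cs) _ => s1 bs1 cs1.
apply: runs_seq (leaf_loop_runs bs1 cs1) _ => s2 bs2 [r0 [B [bal out]]].
apply: (@runs_wp _ _ X0 (SetReg 0 (Get 2 (Reg 0)))) => //=.
  by move: wX; clear; lia.
move=> v ->; exists B; split=> //; apply: outputs_set_reg; rewrite r0 //.
Qed.

End Rounds.

(** * Leaves of acyclic graphs *)

Section Acyclic.

Variables (T : finType) (G : graph T).
Hypothesis simpleG : simple_graph G.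
Hypothesis acyclicG : forall c, ucycle (adj G) c -> size c <= 2.

Lemma adjC x y : adj G x y = adj G y x.
Proof. by rewrite /adj /= setUC. Qed.

Lemma adj_neq x y : adj G x y -> x != y.
Proof.
by move=> /simpleG[_]; rewrite cards2; case: (x != y).
Qed.

(* If every vertex had two neighbours, a path could be extended for ever. *)
Lemma leaf_exists (R : {set T}) : R != set0 ->
  exists2 x, x \in R & forall y z, y \in R -> z \in R -> adj G x y -> adj G x z -> y = z.
Proof.
move=> /set0Pn[x0 x0R]; pose leaf x := [forall y in R, forall z in R,
  (adj G x y) ==> (adj G x z) ==> (y == z)].
case: (boolP [exists x in R, leaf x]) => [/exists_inP[x xR /forall_inP lx]|].
  exists x => // y z yR zR xy xz; have /forall_inP/(_ z zR) := lx y yR.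
  by rewrite xy xz => /eqP.
rewrite negb_exists => /forallP noleaf.
have two x : x \in R -> exists y z, [/\ y \in R, z \in R, y != z, adj G x y & adj G x z].
  move=> xR; have := noleaf x; rewrite xR /= negb_forall => /existsP[y].
  rewrite negb_imply negb_forall => /andP[yR /existsP[z]].
  rewrite !negb_imply => /and4P[zR xy xz yz]; by exists y, z.
have long m : exists x s, [/\ path (adj G) x s, uniq (x :: s), {subset x :: s <= R} & size s = m.+1].
  elim: m => [|m [x [s [pth unq sub sz]]]].
    have [y [z [yR _ _ xy _]]] := two x0 x0R; exists x0, [:: y].
    split=> //=; rewrite ?xy // ?inE ?andbT ?adj_neq //.
    by move=> v; rewrite !inE => /orP[] /eqP ->.
  case: s pth unq sub sz => // y s pth unq sub sz.
  have [z [zR xz zy]] : exists z, [/\ z \in R, adj G x z & z != y].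
    have [a [b [aR bR ab xa xb]]] := two x (sub x (mem_head _ _)).
    case: (eqVneq a y) => [ay|]; last by exists a.
    by exists b; split=> //; rewrite -ay eq_sym.
  case: (boolP (z \in x :: y :: s)) => zin; last first.
    exists z, (x :: y :: s); split=> //.
    - by rewrite /= (adjC z) xz.
    - by rewrite cons_uniq zin.
    - by move=> v; rewrite inE => /orP[/eqP -> //|/sub].
    - by rewrite -sz.
  exfalso; move: zin; rewrite !inE (negbTE zy) /=.
  rewrite eq_sym (negbTE (adj_neq xz)) /= => /splitPr zs.
  case: zs pth unq {sub sz} => s1 s2 pth unq.
  (* The neighbour [z] of [x] lies on the path beyond [y], so the path closes to a cycle with at
     least three vertices. *)
  have := @acyclicG (x :: y :: rcons s1 z) _.
  rewrite /= size_rcons; suff : ucycle (adj G) (x :: y :: rcons s1 z) by move=> h /(_ h).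
  rewrite /ucycle; apply/andP; split.
    rewrite /= rcons_path last_rcons (adjC z) xz andbT.
    by move: pth; rewrite /= -cat_rcons cat_path => /and3P[-> ->].
  by move: unq; rewrite -cat_rcons -!cat_cons cat_uniq => /andP[].
have [x [s [_ unq _ sz]]] := long #|T|.
have : size (x :: s) <= #|T| by rewrite -(card_uniqP unq) max_card.
by rewrite /= sz ltnNge leqnSn.
Qed.

(** Removing a vertex with at most one neighbour in [R] loses at most one edge. *)
Lemma card_edges_within (R : {set T}) : #|edges G ::&: R| <= #|R|.
Proof.
have [m] := ubnP #|R|; elim: m R => // m IH R Rm.
case: (eqVneq R set0) => [->|/leaf_exists[x xR lx]].
  rewrite cards0 leqn0 cards_eq0; apply/eqP/setP=> e; rewrite !inE subset0.
  by apply/andP => -[/simpleG[_ h] /eqP e0]; rewrite e0 cards0 in h.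
have sub : edges G ::&: R \subset
    (edges G ::&: (R :\ x)) :|: [set e in edges G ::&: R | x \in e].
  apply/subsetP => e; rewrite !inE => /andP[eG eR]; rewrite eG eR /=.
  case: (boolP (x \in e)) => xe; rewrite ?orbT // orbF; apply/subsetP => y ye.
  by rewrite !inE (subsetP eR) // andbT; apply: contraNneq xe => <-.
have one : #|[set e in edges G ::&: R | x \in e]| <= 1.
  apply/card_le1_eqP => e f; rewrite !inE => /andP[/andP[eG eR] xe] /andP[/andP[fG fR] xf].
  have oth g : g \in edges G -> g \subset R -> x \in g ->
      exists y, [/\ y \in R, adj G x y & g = [set x; y]].
    move=> gG gR xg; have [_ /eqP/cards2P[a [b [ab gE]]]] := simpleG gG.
    move: xg gR gG; rewrite gE !inE => /orP[/eqP <-|/eqP <-] gR gG.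
      by exists b; split=> //; apply: (subsetP gR); rewrite !inE eqxx orbT.
    exists a; split=> //; [|by rewrite /adj /= setUC | exact: setUC].
    by apply: (subsetP gR); rewrite !inE eqxx.
  have [y [yR xy ->]] := oth _ eG eR xe; have [z [zR xz ->]] := oth _ fG fR xf.
  by rewrite (lx y z).
apply: leq_trans (subset_leq_card sub) _; apply: leq_trans (leq_card_setU _ _).1 _.
rewrite (cardsD1 x R) xR addnC leq_add //; apply: IH.
by move: Rm; rewrite (cardsD1 x R) xR.
Qed.

Lemma card_edges_tree : verts G = [set: T] -> #|edges G| <= #|T|.
Proof.
move=> vG; rewrite -cardsT; apply: leq_trans (card_edges_within _).
by apply/subset_leq_card/subsetP => e eG; rewrite !inE eG subsetT.
Qed.

End Acyclic.

(** * Rooting the tree *)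

(** The number of edges is not part of the input. The loop covers [n] cells, and those past the list
    hold two zeros, which the test for equal ends skips. *)
Definition degree_loop : prog :=
  For 1 (
    SetReg 2 (Get 0 (Reg 1)) ;;
    SetReg 3 (Get 1 (Reg 1)) ;;
    If (Bin Equal (Reg 2) (Reg 3)) Skip (
      Put DEG (Reg 2) (Bin Add (Get DEG (Reg 2)) (Lit 1)) ;;
      Put DEG (Reg 3) (Bin Add (Get DEG (Reg 3)) (Lit 1)) ;;
      Put SUM (Reg 2) (Bin Add (Get SUM (Reg 2)) (Reg 1)) ;;
      Put SUM (Reg 3) (Bin Add (Get SUM (Reg 3)) (Reg 1)))).

(** [ORD] is both the queue and the final numbering of the vertices; register 11 is its length. *)
Definition enqueue (x : nat) : prog :=
  Put ORD (Reg 11) (Reg x) ;; SetReg 11 (Bin Add (Reg 11) (Lit 1)).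

Definition queue_loop : prog :=
  For 1 (If (Bin Less (Get DEG (Reg 1)) (Lit 2)) (enqueue 1) Skip).

(* A vertex leaving the queue has at most one edge left, which is therefore the
   sum of the indices of its remaining edges. *)
Definition strip_loop : prog :=
  For 1 (
    SetReg 2 (Get ORD (Reg 1)) ;;
    Put POS (Reg 2) (Reg 1) ;;
    If (Get DEG (Reg 2)) (
      SetReg 3 (Get SUM (Reg 2)) ;;
      SetReg 4 (Bin Defs.Sub (Bin Add (Get 0 (Reg 3)) (Get 1 (Reg 3))) (Reg 2)) ;;
      Put EID (Reg 1) (Reg 3) ;;
      Put UP (Reg 1) (Reg 4) ;;
      Put DEG (Reg 2) (Lit 0) ;;
      Put SUM (Reg 2) (Lit 0) ;;
      Put DEG (Reg 4) (Bin Defs.Sub (Get DEG (Reg 4)) (Lit 1)) ;;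
      Put SUM (Reg 4) (Bin Defs.Sub (Get SUM (Reg 4)) (Reg 3)) ;;
      If (Bin Equal (Get DEG (Reg 4)) (Lit 1)) (enqueue 4) Skip) Skip).

(** [UP] holds a vertex because the position of a parent is still unknown when its child is
    stripped. *)
Definition parent_loop : prog :=
  For 1 (Put PAR (Reg 1) (Get POS (Get UP (Reg 1)))).

(** * Correctness of the stripping of leaves *)

Section Rooting.

Variables (w X N : nat) (G : graph 'I_N.+1) (es : seq ('I_N.+1 * 'I_N.+1)).
Local Notation T := 'I_N.+1.
Local Notation n := N.+1.
Local Notation m := (size es).
Local Notation E := ('I_(size es)).
Implicit Types (k : E) (F : {set E}) (u v x : T) (s : state) (ql : seq T).

Hypothesis wX : 64 * X < 2 ^ w.
Hypothesis nX : n.+2 * n.+2 <= X.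
Hypothesis vertsG : verts G = [set: T].
Hypothesis simpleG : simple_graph G.
Hypothesis acyclicG : forall c, ucycle (adj G) c -> size c <= 2.
Hypothesis connectedG : forall x y : T, connect (adj G) x y.
Hypothesis esG : edge_list G es.

Definition ed k : T * T := tnth (in_tuple es) k.
Definition en k : {set T} := edge_of (ed k).

Lemma en_in k : en k \in edges G.
Proof.
rewrite -mem_enum -(perm_mem esG); apply: map_f; exact: mem_tnth.
Qed.

Lemma edges_en e : e \in edges G -> exists k, e = en k.
Proof.
rewrite -mem_enum -(perm_mem esG) => /mapP[z /seq_tnthP[k zk] ->].
by exists k; rewrite /en /ed -zk.
Qed.

Lemma en_inj : injective en.
Proof.
move=> k l e; have unq : uniq [seq edge_of z | z <- es].
  by rewrite (perm_uniq esG) enum_uniq.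
apply/val_inj/eqP; rewrite /= -(nth_uniq (edge_of (ed k)) _ _ unq) ?size_map //.
move: e; rewrite /en /ed !(tnth_nth (ed k)) /= => e.
by rewrite !(nth_map (ed k)) // e.
Qed.

Lemma ed_neq k : (ed k).1 != (ed k).2.
Proof.
have [_] := simpleG (en_in k); rewrite /en /edge_of cards2.
by case: ((ed k).1 != (ed k).2).
Qed.

(** Loops over [n] cells therefore reach every edge. *)
Lemma size_es : m <= n.
Proof.
rewrite -(size_map (@edge_of _)) (perm_size esG) -cardE -[X in _ <= X]card_ord.
exact: card_edges_tree.
Qed.

Definition edge_mem s : Prop :=
  (forall k, arr s 0 k = (ed k).1 /\ arr s 1 k = (ed k).2) /\
  (forall i, m <= i -> arr s 0 i = 0 /\ arr s 1 i = 0).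

Lemma in_en k x : (x \in en k) = (x == (ed k).1) || (x == (ed k).2).
Proof. by rewrite !inE. Qed.

#[local] Opaque en.

Definition inc F x : {set E} := [set k in F | x \in en k].
Definition deg F x : nat := #|inc F x|.
Definition ssum F x : nat := \sum_(k in inc F x) k.

Definition degree_mem F s : Prop :=
  forall x, arr s DEG x = deg F x /\ arr s SUM x = ssum F x.

Lemma in_inc F x k : (k \in inc F x) = (k \in F) && (x \in en k).
Proof. by rewrite in_set. Qed.

Lemma inc_add F k x :
  inc (k |: F) x = if x \in en k then k |: inc F x else inc F x.
Proof.
apply/setP=> l; rewrite in_inc (in_setU1 l k); case: eqVneq => [->|lk] /=.
  by case: ifP => h; rewrite ?setU11 // in_inc h andbF.
by case: ifP => h; rewrite ?(in_setU1 l k) ?(negbTE lk) in_inc.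
Qed.

Lemma deg_add F k x : k \notin F -> deg (k |: F) x = (x \in en k) + deg F x.
Proof.
move=> kF; rewrite /deg inc_add; case: ifP => // _.
by rewrite cardsU1 in_inc (negbTE kF).
Qed.

Lemma ssum_add F k x : k \notin F -> ssum (k |: F) x = (x \in en k) * k + ssum F x.
Proof.
move=> kF; rewrite /ssum inc_add; case: ifP => // _.
by rewrite big_setU1 ?mul1n // in_inc (negbTE kF).
Qed.

Lemma deg_le F x : deg F x <= n.
Proof. by apply: leq_trans (max_card _) _; rewrite card_ord size_es. Qed.

(** It is this bound that makes [X] quadratic in [n]. *)
Lemma ssum_le F x : ssum F x <= n * n.
Proof.
apply: leq_trans (_ : \sum_(k in inc F x) n <= _).
  by apply: leq_sum => k _; apply: leq_trans (ltnW (ltn_ord k)) size_es.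
by rewrite sum_nat_const leq_mul2r deg_le orbT.
Qed.

Lemma degree_loop_runs s : bounded X s -> reg s 0 = n -> edge_mem s ->
  (forall x, arr s DEG x = 0 /\ arr s SUM x = 0) ->
  runs w X degree_loop s (loop_time N)
    (fun s' => degree_mem [set: E] s' /\ same_off degree_loop s s').
Proof.
move=> bs r0 em z0.
pose Fi (i : nat) : {set E} := [set k | val k < i].
pose I (i : nat) s' := edge_mem s' /\ degree_mem (Fi i) s'.
apply: runs_weaken (leqnn _) _.
  apply: (@runs_for_wp w X n 1 _ _ I) => //; first by move: nX; clear; nia.
    move=> i s1 iN bs1 _ ri [[em1 em2] dm] /= a aE b bE; rewrite ri in aE bE *.
    case: (ltnP i m) => im; last first.
      have [h1 h2] := em2 i im; rewrite bE aE h1 h2 /= /I.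
      have -> : Fi i.+1 = Fi i; last by [].
      apply/setP=> k; rewrite !inE; have km := leq_trans (ltn_ord k) im.
      by rewrite ltnS (ltnW km) km.
    pose k : E := Ordinal im.
    have [h1 h2] := em1 k; rewrite bE aE h1 h2 val_eqE (negbTE (ed_neq k)) /=.
    have kF : k \notin Fi i by rewrite inE ltnn.
    have FE : Fi i.+1 = k |: Fi i.
      by apply/setP=> l; rewrite !inE ltnS leq_eqVlt -val_eqE.
    have ne : (ed k).2 != (ed k).1 by rewrite eq_sym ed_neq.
    rewrite !val_eqE (negbTE ne) !(dm _).1 !(dm _).2.
    have dX x : deg (Fi i) x + 1 <= X by have := deg_le (Fi i) x; move: nX; clear; nia.
    have sX x : ssum (Fi i) x + i <= X.
      by have := ssum_le (Fi i) x; move: iN nX; clear; nia.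
    split=> //; split=> //; split=> //; split=> //; split=> //.
    rewrite FE => x; rewrite deg_add // ssum_add // in_en /= !val_eqE.
    case: (eqVneq x (ed k).2) => [->|x2].
      by rewrite orbT mul1n; split; rewrite addnC.
    case: (eqVneq x (ed k).1) => [->|x1] /=; last exact: dm.
    by rewrite mul1n; split; rewrite addnC.
  split=> // x; have -> : Fi 0 = set0 by apply/setP=> k; rewrite !inE.
  have e0 : inc set0 x = set0 by apply/setP=> k; rewrite in_inc !in_set0.
  by rewrite /deg /ssum e0 cards0 big_set0; apply: z0.
move=> s' _ [[_ dm] so]; split=> //.
suff <- : Fi n = [set: E] by [].
by apply/setP=> k; rewrite !inE (leq_trans (ltn_ord k) size_es).
Qed.

Definition queue_mem ql s : Prop :=
  reg s 11 = size ql /\ forall j, j < size ql -> arr s ORD j = nth ord0 ql j.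

Lemma queue_mem_rcons ql s x s' : queue_mem ql s ->
  reg s' 11 = (size ql).+1 ->
  (forall j, arr s' ORD j = if j == size ql then val x else arr s ORD j) ->
  queue_mem (rcons ql x) s'.
Proof.
move=> [r11 q1] r11' q'; split=> [|j]; first by rewrite size_rcons.
rewrite size_rcons ltnS leq_eqVlt q' nth_rcons; case: (ltngtP j (size ql)) => // jq _.
exact: q1.
Qed.

Lemma uniq_size ql : uniq ql -> size ql <= n.
Proof. by move=> /card_uniqP <-; rewrite -[leqRHS]card_ord max_card. Qed.

Lemma queue_loop_runs F s : bounded X s -> reg s 0 = n -> reg s 11 = 0 -> degree_mem F s ->
  runs w X queue_loop s (loop_time N)
    (fun s' => (exists ql, [/\ queue_mem ql s', uniq ql & forall x, (x \in ql) = (deg F x < 2)])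
       /\ same_off queue_loop s s').
Proof.
move=> bs r0 r11 dm.
pose I (i : nat) s' := degree_mem F s' /\ exists ql,
  [/\ queue_mem ql s', uniq ql & forall x, (x \in ql) = (x < i) && (deg F x < 2)].
apply: runs_weaken (leqnn _) _.
  apply: (@runs_for_wp w X n 1 _ _ I) => //; first by move: nX; clear; nia.
    move=> i s1 iN bs1 _ ri [dm1 [ql [[q11 q1] uq memq]]] /=; rewrite ri.
    pose x : T := Ordinal iN; rewrite -[i]/(val x) (dm1 x).1.
    case: (ltnP (deg F x) 2) => dx /=.
      have xq : x \notin ql by rewrite memq ltnn.
      have su : size (rcons ql x) <= n by apply: uniq_size; rewrite rcons_uniq xq.
      rewrite size_rcons in su; split; first by rewrite q11; move: su nX; clear; nia.
      move=> v vE; split=> //; exists (rcons ql x); split.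
      - apply: queue_mem_rcons (conj q11 q1) _ _; first by rewrite /= vE q11 addn1.
        by move=> j; rewrite /= q11.
      - by rewrite rcons_uniq xq.
      - move=> y; rewrite mem_rcons in_cons memq [in RHS]ltnS [in RHS]leq_eqVlt andb_orl.
        case: (eqVneq y x) => [->|yx] /=; first by rewrite eqxx dx.
        by rewrite -val_eqE /= in yx; rewrite (negbTE yx).
    split=> //; exists ql; split=> // y; rewrite memq [in RHS]ltnS [in RHS]leq_eqVlt.
    case: (eqVneq y x) => [->|yx]; first by rewrite (leq_gtF dx) !andbF.
    by rewrite -val_eqE /= in yx; rewrite (negbTE yx).
  by split=> //; exists [::].
move=> s' _ [[_ [ql [h1 h2 h3]]] so]; split=> //; exists ql; split=> // x.
by rewrite h3 ltn_ord.
Qed.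

Lemma other_end k x : x \in en k -> exists y,
  [/\ en k = [set x; y], x != y & (ed k).1 + (ed k).2 - x = y].
Proof.
have ne := ed_neq k; rewrite in_en => /orP[] /eqP ->.
  by exists (ed k).2; split=> //; rewrite addKn.
by exists (ed k).1; rewrite eq_sym; split=> //; [rewrite setUC | rewrite addnK].
Qed.

Definition queue_inv F ql (h : nat) : Prop :=
  [/\ uniq ql, forall x, (x \in ql) = (deg F x < 2), h <= size ql &
      forall j, j < h -> deg F (nth ord0 ql j) = 0].

(** Otherwise all queued vertices are processed and have degree [0] in [F]. The vertices outside the
    queue have degree at least 2, and their edges of [F] stay among themselves, against
    [leaf_exists]. *)
Lemma queue_nonempty F ql h : queue_inv F ql h -> h < n -> h < size ql.
Proof.
move=> [uq memq hq dq] hn; rewrite ltn_neqAle hq andbT; apply/eqP => hE.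
have Rn0 : [set x | x \notin ql] != set0.
  apply: contraTneq hn => R0; rewrite -leqNgt hE -(card_uniqP uq) -[leqLHS]card_ord.
  apply/subset_leq_card/subsetP => x _; apply/negPn/negP => xq.
  by move/setP/(_ x): R0; rewrite !inE xq.
have [x] := leaf_exists simpleG acyclicG Rn0; rewrite inE memq -leqNgt => dx lx.
have nbr k : k \in inc F x -> exists y, [/\ y \in [set x | x \notin ql], adj G x y & en k = [set x; y]].
  rewrite in_inc => /andP[kF /other_end[y [kE xy _]]]; exists y; split=> //.
    rewrite inE; apply/negP => /(nthP ord0)[j jq yE].
    have : deg F y = 0 by rewrite -yE dq // hE.
    move/eqP; rewrite cards_eq0 => /eqP/setP/(_ k).
    by rewrite in_inc kF kE in_set2 eqxx orbT inE.
  by rewrite /adj /= -kE en_in.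
have : ~~ (deg F x <= 1) by rewrite -ltnNge.
move/negP; apply; apply/card_le1_eqP => k l /nbr[y [yR xy kE]] /nbr[z [zR xz lE]].
by apply: en_inj; rewrite kE lE (lx y z).
Qed.

(* [pe j] is the edge that the vertex number [j] of the queue loses together with
   the other end of this edge, if that vertex is not the root. *)
Definition strip_inv F ql (pe : nat -> option (E * T)) (h : nat) s : Prop :=
  [/\ degree_mem F s, queue_mem ql s, queue_inv F ql h,
      forall j, j < h -> arr s POS (nth ord0 ql j) = j &
      (forall k, k \notin F -> exists j u, j < h /\ pe j = Some (k, u)) /\
      forall j k u, j < h -> pe j = Some (k, u) -> [/\ arr s EID j = k, arr s UP j = u,
        en k = [set nth ord0 ql j; u] & forall i, i <= j -> u != nth ord0 ql i]].

Lemma strip_loop_runs s ql : bounded X s -> reg s 0 = n -> edge_mem s ->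
  degree_mem [set: E] s -> queue_mem ql s -> uniq ql ->
  (forall x, (x \in ql) = (deg [set: E] x < 2)) ->
  runs w X strip_loop s (loop_time N)
    (fun s' => (exists F ql' pe, strip_inv F ql' pe n s') /\ same_off strip_loop s s').
Proof.
move=> bs r0 em dm0 qm0 uq0 memq0.
pose I (h : nat) s' := edge_mem s' /\ exists F ql pe, strip_inv F ql pe h s'.
apply: runs_weaken (leqnn _) _.
  apply: (@runs_for_wp w X n 1 _ _ I) => //; first by move: nX; clear; nia.
    move=> h s1 hn bs1 _ ri [em1 [F [ql1 [pe [dm qm qi pm [eF ep]]]]]] /=; rewrite ri.
    have hq := queue_nonempty qi hn; have [uq memq _ dq] := qi.
    have [q11 q1] := qm.
    move=> v' v'E; rewrite q1 // in v'E; subst v'.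
    set v := nth ord0 ql1 h.
    have vql : v \in ql1 by apply: mem_nth.
    have pos_step j : j < h.+1 -> (if nth ord0 ql1 j == v then h else arr s1 POS (nth ord0 ql1 j)) = j.
      rewrite ltnS leq_eqVlt; case: (eqVneq j h) => [-> _|jh /= jlt]; first by rewrite eqxx.
      rewrite nth_uniq ?(negbTE jh) ?pm //; exact: ltn_trans jlt hq.
    rewrite (dm v).1; case: (posnP (deg F v)) => dv /=.
      split=> //; exists F, ql1, (fun j => if j == h then None else pe j); split=> //.
      - split=> // j; rewrite ltnS leq_eqVlt; case: eqP => [-> //|_] /=; exact: dq.
      - split=> [k /eF[j [u [jh pj]]]|j k u].
          by exists j, u; rewrite ltn_eqF // ltnS ltnW.
        rewrite ltnS leq_eqVlt; case: eqP => //= _; exact: ep.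
    have dv1 : deg F v = 1 by apply/eqP; rewrite eqn_leq dv andbT -ltnS -memq.
    have [k incE] : exists k, inc F v = [set k] by apply/cards1P/eqP.
    have /andP[kF vk] : (k \in F) && (v \in en k) by rewrite -in_inc incE set11.
    have [u [kE vu uE]] := other_end vk.
    move=> e; rewrite (dm v).2 {1}/ssum incE big_set1 => -> {e}.
    rewrite (em1.1 k).1 (em1.1 k).2 uE; split.
      by apply: leq_trans (ltnW (ltn_ord u)) _; move: nX; clear; nia.
    move=> v1 ->{v1}; rewrite eqxx !val_eqE.
    have uv : (u == v) = false by rewrite eq_sym (negbTE vu).
    rewrite uv (dm u).1 (dm u).2.
    pose F' := F :\ k.
    have FE : F = k |: F' by rewrite setD1K.
    have kF' : k \notin F' by rewrite !inE eqxx.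
    have dF x : deg F x = (x \in [set v; u]) + deg F' x by rewrite FE deg_add // kE.
    have sF x : ssum F x = (x \in [set v; u]) * k + ssum F' x by rewrite FE ssum_add // kE.
    have du : deg F u = (deg F' u).+1 by rewrite dF set22.
    have dv0 : deg F' v = 0 by have := dF v; rewrite dv1 set21 add1n => -[].
    (* The other end [u] still has an edge, so it has not been processed; this makes parents come
       after their children. *)
    have hu j : j <= h -> u != nth ord0 ql1 j.
      rewrite leq_eqVlt => /orP[/eqP ->|/dq dj]; first by rewrite eq_sym.
      by apply/eqP => uj; move: dj; rewrite -uj du.
    have fin ql2 s2 : (forall j, j < size ql1 -> nth ord0 ql2 j = nth ord0 ql1 j) ->
        uniq ql2 -> (forall x, (x \in ql2) = (deg F' x < 2)) -> size ql1 <= size ql2 ->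
        queue_mem ql2 s2 -> (forall a, a \in [:: 0; 1] -> arr s2 a =1 arr s1 a) ->
        (forall x, arr s2 DEG x = if x == u then deg F u - 1 else if x == v then 0 else arr s1 DEG x) ->
        (forall x, arr s2 SUM x = if x == u then ssum F u - k else if x == v then 0 else arr s1 SUM x) ->
        (forall j, arr s2 POS j = if j == v then h else arr s1 POS j) ->
        (forall j, arr s2 EID j = if j == h then val k else arr s1 EID j) ->
        (forall j, arr s2 UP j = if j == h then val u else arr s1 UP j) ->
        I h.+1 s2.
      move=> pre uq2 mq2 sz2 qm2 same deg2 sum2 pos2 eid2 up2.
      have dm2 : degree_mem F' s2.
        move=> x; rewrite deg2 sum2; case: (eqVneq x u) => [->|xu].
          by rewrite du subn1 sF set22 mul1n addKn.
        case: (eqVneq x v) => [->|xv].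
          have := sF v; rewrite {1}/ssum incE big_set1 set21 mul1n => sv.
          by split=> //; move: sv; clear; lia.
        by rewrite (dm x).1 (dm x).2 dF sF in_set2 (negbTE xu) (negbTE xv).
      split.
        by split=> i; [split; rewrite same // | move=> im; rewrite !same //];
          [exact: (em1.1 i).1 | exact: (em1.1 i).2 | exact: em1.2].
      have lt j : j < h.+1 -> j < size ql1 by move=> jh; apply: leq_trans jh hq.
      exists F', ql2, (fun j => if j == h then Some (k, u) else pe j); split=> //.
      - split=> //; first exact: leq_trans hq sz2.
        move=> j jh; rewrite pre ?lt //; move: jh; rewrite ltnS leq_eqVlt.
        case/orP=> [/eqP ->|/dq dj]; first exact: dv0.
        by have := dF (nth ord0 ql1 j); rewrite dj => /esym/eqP; rewrite addn_eq0 => /andP[_ /eqP].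
      - by move=> j jh; rewrite pos2 pre ?lt // val_eqE; apply: pos_step.
      - split=> [l lF|j l y].
          case: (eqVneq l k) => [->|lk]; first by exists h, u; rewrite eqxx.
          have [j [y [jh pj]]] : exists j y, j < h /\ pe j = Some (l, y).
            by apply: eF; move: lF; rewrite !inE lk.
          by exists j, y; rewrite ltn_eqF // ltnS ltnW.
        move=> jh; have jq := lt _ jh; rewrite eid2 up2 pre //.
        have pre' i : i <= j -> nth ord0 ql2 i = nth ord0 ql1 i.
          by move=> ij; apply/pre/(leq_ltn_trans ij jq).
        move: jh; rewrite ltnS leq_eqVlt; case: eqP => [-> _ [<- <-]|_ /= jh pj].
          by split=> // i ih; rewrite pre ?hu //; apply: lt; rewrite ltnS.
        have [h1 h2 h3 h4] := ep _ _ _ jh pj; split=> // i ij; rewrite pre' //; exact: h4.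
    (* [u] joins the queue exactly when its degree drops to 1; if it drops to 0, it had degree 1 and
       was queued before. *)
    case: (eqVneq (deg F' u) 1) => du'; rewrite du subn1 /=; last first.
      rewrite (negbTE du') /=; apply: (fin ql1) => //=.
      - move=> x; rewrite memq dF in_set2; case: (eqVneq x v) => [->|xv].
          by rewrite dv0.
        case: (eqVneq x u) => [->|xu] //=.
        by move: du'; clear; case: (deg F' u) => [|[|]].
      - by move=> a; rewrite !inE => /orP[] /eqP ->.
      - by move=> x; rewrite -?val_eqE du subn1.
    rewrite du' /=; have uq' : u \notin ql1 by rewrite memq du du'.
    have su : size (rcons ql1 u) <= n by apply: uniq_size; rewrite rcons_uniq uq'.
    rewrite size_rcons in su; rewrite q11; split; first by move: su nX; clear; nia.
    move=> z ->; apply: (fin (rcons ql1 u)) => //=.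
    - by move=> j jq; rewrite nth_rcons jq.
    - by rewrite rcons_uniq uq'.
    - move=> x; rewrite mem_rcons in_cons memq dF in_set2.
      case: (eqVneq x v) => [->|xv].
        by rewrite dv0 orbT.
      by case: (eqVneq x u) => [->|xu] //=; rewrite du'.
    - by rewrite size_rcons.
    - apply: queue_mem_rcons qm _ _ => //=; first by rewrite addn1.
    - by move=> a; rewrite !inE => /orP[] /eqP ->.
    - by move=> x; rewrite -?val_eqE du du' subn1.
  split=> //; exists [set: E], ql, (fun=> None); split=> //.
  by split=> // k; rewrite inE.
by move=> s' _ [[_ h] so].
Qed.

Record rooting (p q : T -> T) (eid : T -> nat) : Prop := Rooting {
  rooting_gt : forall j : T, j != ord_max -> j < p j;
  rooting_inj : injective q;
  rooting_edges : edges G = link p q @: [set~ ord_max];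
  rooting_eid_lt : forall j : T, j != ord_max -> eid j < n;
  rooting_eid_inj : forall i j : T, i != ord_max -> j != ord_max -> eid i = eid j -> i = j;
  rooting_eid_link : forall j : T, j != ord_max ->
    onth [seq edge_of e | e <- es] (eid j) = Some (link p q j) }.

Lemma onth_edge k : onth [seq edge_of e | e <- es] k = Some (en k).
Proof.
have h := ltn_ord k; rewrite onthE -map_comp (nth_map (ed k)) //.
by rewrite /= -(tnth_nth (ed k) (in_tuple es)).
Qed.

(** After [n] steps all vertices are stripped and no edge is left. Connectedness shows that only the
    last vertex went without handing over an edge to a parent. *)
Lemma strip_rooting F ql pe s : strip_inv F ql pe n s -> exists p q eid,
  rooting p q eid /\ forall j : T, [/\ arr s ORD j = q j, arr s POS (q j) = j &
    j != ord_max -> arr s EID j = eid j /\ arr s UP j = q (p j)].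
Proof.
move=> [_ [_ ordq] [uq _ hq dq] posq [eF ep]].
have szq : size ql = n by apply/eqP; rewrite eqn_leq uniq_size.
have allq x : x \in ql.
  apply/negPn/negP => xq; have : size (rcons ql x) <= n.
    by apply: uniq_size; rewrite rcons_uniq xq.
  by rewrite size_rcons szq ltnn.
pose q (j : T) := nth ord0 ql j.
have q_inj : injective q.
  by move=> i j /eqP; rewrite nth_uniq ?szq // => /eqP/val_inj.
pose ix x : T := inord (index x ql).
have ixE x : index x ql = ix x by rewrite inordK // -[X in _ < X]szq index_mem.
have qix x : q (ix x) = x by rewrite /q -ixE nth_index.
have ixq j : ix (q j) = j by apply: q_inj; rewrite qix.
have notF k : k \notin F.
  apply/negP => kF; have /(nthP ord0)[j jq jE] := allq (ed k).1.
  have : deg F (ed k).1 = 0 by rewrite -jE dq // -[X in _ < X]szq.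
  move/eqP; rewrite cards_eq0 => /eqP/setP/(_ k).
  by rewrite in_inc kF in_en eqxx inE.
pose up (i : T) : T := if pe (val i) is Some (_, u) then ix u else i.
have up_gt (i : T) k u : pe (val i) = Some (k, u) -> i < up i.
  move=> pi; have [_ _ _ h] := ep _ _ _ (ltn_ord i) pi.
  rewrite /up pi ltnNge; apply/negP => /h; rewrite -/(q (ix u)) qix eqxx //.
have edgeP x y : adj G x y -> exists (i : T) k u,
    [/\ pe (val i) = Some (k, u), [set x; y] = [set q i; q (up i)] & en k = [set x; y]].
  move=> /edges_en[k kE]; have [j [u [jn pj]]] := eF k (notF k).
  exists (Ordinal jn), k, u; split=> //.
  have [_ _ h _] := ep _ _ _ jn pj.
  by rewrite /up /= pj qix kE h.
(* A parentless [j] is a fixed point of [up]. That an ascent ends in [j] is a property constant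
   along edges, hence shared by all vertices, also the last one; as [up] never descends, [j] is the
   last position. *)
have someP (j : T) : j != ord_max -> exists k u, pe (val j) = Some (k, u).
  move=> jm; case pj: (pe (val j)) => [[k u]|]; first by exists k, u.
  pose lab x := fconnect up (ix x) j.
  have lab_up (i : T) k u : pe (val i) = Some (k, u) -> lab (q i) = lab (q (up i)).
    move=> pi; rewrite /lab !ixq fconnect_eqVf; case: eqVneq => // ij.
    by rewrite -ij pi in pj.
  have lab_adj x y : adj G x y -> lab x = lab y.
    move=> /edgeP[i [k [u [pi xy _]]]]; have li := lab_up _ _ _ pi.
    have : x \in [set q i; q (up i)] by rewrite -xy set21.
    have : y \in [set q i; q (up i)] by rewrite -xy set22.
    by rewrite !in_set2 => /orP[]/eqP -> /orP[]/eqP ->; rewrite ?li.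
  have lab_all x y : lab x = lab y.
    case/connectP: (connectedG x y) => t; elim: t x => [x _ ->//|z t IH x] /= /andP[xz pt] l.
    by rewrite (lab_adj _ _ xz); apply: IH.
  have : lab (q ord_max) by rewrite (lab_all _ (q j)) /lab ixq connect0.
  rewrite /lab ixq => c; exfalso; move/eqP: jm; apply.
  have up_ge (i : T) : i <= up i.
    case pi: (pe (val i)) => [[k u]|]; first exact/ltnW/(up_gt _ _ _ pi).
    by rewrite /up pi.
  have ge a : N <= iter a up ord_max.
    by elim: a => //= a h; apply: leq_trans h (up_ge _).
  have : N <= j by rewrite -(iter_findex c); apply: ge.
  by move=> h; apply/val_inj/eqP; rewrite eqn_leq h leq_ord.
pose eid (j : T) : nat := if pe (val j) is Some (k, _) then k else 0.
have linkE (j : T) k u : pe (val j) = Some (k, u) -> link up q j = en k.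
  move=> pj; have [_ _ -> _] := ep _ _ _ (ltn_ord j) pj.
  by rewrite /link /up pj qix.
exists up, q, eid; split; last first.
  move=> j; split; [by rewrite ordq ?szq | by rewrite posq |].
  move=> /someP[k [u pj]]; have [h1 h2 _ _] := ep _ _ _ (ltn_ord j) pj.
  by rewrite h1 h2 /eid /up pj qix.
have gt (j : T) : j != ord_max -> j < up j by move=> /someP[k [u]]; apply: up_gt.
split=> //.
- apply/setP=> e; apply/idP/imsetP => [eG|[j]].
    have [k kE] := edges_en eG; have [j [u [jn pj]]] := eF k (notF k).
    exists (Ordinal jn); last by rewrite (linkE _ k u).
    rewrite !inE; apply/eqP => jm; have := up_gt (Ordinal jn) k u pj.
    by rewrite jm ltnNge leq_ord.
  by rewrite !inE => /someP[k [u pj]] ->; rewrite (linkE _ _ _ pj) en_in.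
- move=> j /someP[k [u pj]]; rewrite /eid pj; exact: leq_trans (ltn_ord k) size_es.
- move=> i j im jm; have [k [u pi]] := someP _ im; have [l [y pj]] := someP _ jm.
  rewrite /eid pi pj => /val_inj kl; apply: (link_inj gt q_inj im jm).
  by rewrite (linkE _ _ _ pi) (linkE _ _ _ pj) kl.
- by move=> j /someP[k [u pj]]; rewrite (linkE _ _ _ pj) /eid pj onth_edge.
Qed.

End Rooting.

(** * The program *)

(** A single piece, rooted at position [n - 1] and waiting in the sentinel cell; [SIDE] is still
    zero from the start. Register 10 begins with the number of edges, [n - 1]. *)
Definition init_pieces : prog :=
  SetReg 2 (Bin Defs.Sub (Reg 0) (Lit 1)) ;;
  Put CUT (Reg 2) (Lit 1) ;;
  Put SLOT (Reg 2) (Reg 0) ;;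
  SetReg 10 (Reg 2).

Definition balanced_cut_prog : prog :=
  degree_loop ;; queue_loop ;; strip_loop ;; parent_loop ;; init_pieces ;; cutting.

Section Program.

Variables (w X N : nat) (G : graph 'I_N.+1) (es : seq ('I_N.+1 * 'I_N.+1)).
Local Notation T := 'I_N.+1.
Local Notation n := N.+1.

Hypothesis wX : 64 * X < 2 ^ w.
Hypothesis nX : n.+2 * n.+2 <= X.
Hypothesis vertsG : verts G = [set: T].
Hypothesis treeG : is_tree G.
Hypothesis esG : edge_list G es.

Let X0 : 0 < X. Proof. by move: nX; clear; lia. Qed.

Lemma parent_loop_runs (p q : T -> T) s : bounded X s -> reg s 0 = n ->
  (forall j : T, arr s POS (q j) = j) ->
  (forall j : T, j != ord_max -> arr s UP j = q (p j)) ->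
  runs w X parent_loop s (loop_time N)
    (fun s' => (forall j : T, j != ord_max -> arr s' PAR j = p j) /\ same_off parent_loop s s').
Proof.
move=> bs r0 posq upq.
pose I (k : nat) s' := [/\ forall j : T, arr s' POS (q j) = j,
  forall j : T, j != ord_max -> arr s' UP j = q (p j) &
  forall j : T, j < k -> j != ord_max -> arr s' PAR j = p j].
apply: runs_weaken (leqnn _) _.
  apply: (@runs_for_wp w X n 1 _ _ I) => //; first by move: nX; clear; nia.
  move=> k s1 kn bs1 _ rk [pos1 up1 par1] /=; split=> // j; rewrite rk ltnS leq_eqVlt /=.
  by case: eqP => /= [<- _ jm|_]; [rewrite up1 // pos1 | exact: par1].
by move=> s' _ [[_ _ h] so]; split=> // j; apply: h.
Qed.

Lemma input_bounded : bounded X (input es).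
Proof.
have nX' : n <= X by move: nX; clear; nia.
split=> [x|a i] /=; first by case: ifP.
case: a => [|[|a]] //; set l := map _ _;
  (have [im|im] := ltnP i (size l); last by rewrite nth_default);
  have /mapP[e _ ->] := mem_nth 0 im; exact: leq_trans (ltnW (ltn_ord _)) nX'.
Qed.

Lemma input_edges : edge_mem es (input es).
Proof.
split=> [k|i im] /=; last by rewrite !nth_default ?size_map.
by rewrite !(nth_map (ed k)) // -(tnth_nth (ed k) (in_tuple es)).
Qed.

Definition program_time := 4 * loop_time N + 20 + cutting_time N.

Lemma balanced_cut_runs :
  runs w X balanced_cut_prog (input es) program_time (fun s' => exists B,
    balanced_ept G B /\ outputs es s' (reg s' 0) B).
Proof.
have [simpleG _ conn acyclicG] := treeG.
have connG x y : connect (adj G) x y by apply: conn; rewrite vertsG inE.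
have -> : program_time = loop_time N + (loop_time N + (loop_time N + (loop_time N +
    (20 + cutting_time N)))) by rewrite /program_time; clear; lia.
apply: runs_seq (degree_loop_runs wX nX vertsG simpleG acyclicG esG input_bounded
  erefl input_edges (fun x => conj erefl erefl)) _ => s1 bs1 [dm1 so1].
have r1 : reg s1 0 = n by rewrite so1.1.
have r11 : reg s1 11 = 0 by rewrite so1.1.
apply: runs_seq (queue_loop_runs wX nX bs1 r1 r11 dm1) _ => s2 bs2 [[ql [qm uq mq]] so2].
have r2 : reg s2 0 = n by rewrite so2.1.
have dm2 : degree_mem [set: 'I_(size es)] s2 by move=> x; rewrite !so2.2.
have em2 : edge_mem es s2.
  have [h1 h2] := input_edges; split=> [k|i im]; rewrite !so2.2 // !so1.2 //.
  exact: h2.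
apply: runs_seq (strip_loop_runs wX nX simpleG acyclicG esG bs2 r2 em2 dm2 qm uq mq) _.
move=> s3 bs3 [[F [ql' [pe inv]]] so3].
have r3 : reg s3 0 = n by rewrite so3.1.
have [p [q [eid [[gt qi edgesE elt einj elink] mem]]]] :=
  strip_rooting vertsG simpleG acyclicG connG esG inv.
have posq j : arr s3 POS (q j) = j by case: (mem j).
have upq j : j != ord_max -> arr s3 UP j = q (p j) by move=> jm; case: (mem j) => _ _ /(_ jm)[].
apply: runs_seq (parent_loop_runs bs3 r3 posq upq) _ => s4 bs4 [par so4].
have r4 : reg s4 0 = n by rewrite so4.1.
have tm4 : tree_mem p q eid s4.
  by split=> [j|//|j jm]; rewrite so4.2 //; case: (mem j) => // _ _ /(_ jm)[].
have zero a : a \in [:: CUT; SIDE] -> forall i, arr s4 a i = 0.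
  by rewrite !inE => /orP[] /eqP -> i; rewrite so4.2 // so3.2 // so2.2 // so1.2.
apply: (@runs_seq _ _ _ _ _ _ _ (cut_state p q G es eid [set ord_max])).
  apply: (runs_weaken (runs_wp X0 (Q := cut_state p q G es eid [set ord_max]) _ bs4 _)) => //.
    by apply: leq_ltn_trans wX; rewrite leq_mul2r; apply/orP; right.
  rewrite /init_pieces /= r4 subn1 /= => v -> v' ->; split.
  - exact: tm4.
  - by move=> j; rewrite /= zero // inE -val_eqE; case: (_ == _).
  - by rewrite /= cardsC1 card_ord.
  - by [].
  - split; first exact: set11.
    apply: assembly_init => //=; first by rewrite eqxx.
    by rewrite zero.
by move=> s5 bs5 cs5; apply: cutting_runs cs5.
Qed.

End Program.

(** With [L] the logarithm, [n + 2 <= 2 ^ (L + 2)], so the left side is at most [2 ^ (2 L + 10)];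
    the 11 is chosen for [2 L + 10 < 11 (L + 1)], also at [L = 0]. *)
Lemma word_size (n : nat) : 0 < n ->
  64 * (n.+2 * n.+2) < 2 ^ (11 * (trunc_log 2 n).+1).
Proof.
move=> n0; have nL : n < 2 ^ (trunc_log 2 n).+1 by apply: trunc_log_ltn.
move: (trunc_log 2 n) nL => L nL.
have n2 : n.+2 <= 2 ^ L.+2 by rewrite expnS; move: nL n0; clear; lia.
apply: (@leq_ltn_trans (2 ^ 6 * (2 ^ L.+2 * 2 ^ L.+2))).
  by rewrite leq_mul2l leq_mul.
by rewrite -!expnD ltn_exp2l //; clear; lia.
Qed.

Lemma program_time_bigO :
  bigO (fun n => program_time n.-1) (fun n => n * trunc_log 2 n).
Proof.
(* From [n = 2] on the logarithm is positive and absorbs the linear terms; 5000 is a generous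
   constant. *)
exists 5000, 2 => -[|[|m]] // _; rewrite /program_time /cutting_time /cutting_loop_time.
rewrite /round_time /sweep_time /loop_time /for_time /=.
have : 0 < trunc_log 2 m.+2 by rewrite trunc_log_gt0.
move: (trunc_log 2 m.+2) => L L0; nia.
Qed.

Theorem theorem1 :
  exists (p : prog) (k : nat) (f : nat -> nat),
    bigO f (fun n => n * trunc_log 2 n) /\
    forall (n : nat) (G : graph 'I_n) (es : seq ('I_n * 'I_n)),
      verts G = [set: 'I_n] -> is_tree G -> edge_list G es ->
      exists (t : nat) (s : state) (B : ept 'I_n),
        [/\ exec (k * (trunc_log 2 n).+1) p (input es) t s,
            t <= f n,
            balanced_ept G B &
            outputs es s (reg s 0) B].
Proof.
exists balanced_cut_prog, 11, (fun n => program_time n.-1); split.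
  exact: program_time_bigO.
move=> [|N] G es vertsG treeG esG.
  case: treeG => _ /set0Pn[] [] //.
have [t [s [ex tT _ [B [bal out]]]]] :=
  balanced_cut_runs (word_size (ltn0Sn N)) (leqnn _) vertsG treeG esG.
by exists t, s, B.
Qed.
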